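(* Let $b$ be a birth-death chain over $(X,m)$ with $X=\mathbb N_0$. If the Neumann semigroup is Feller, then $L_c$ is essentially self-adjoint.
   Context: A birth-death chain over $(X,m)$, $X=\mathbb N_0$, consists of $m:X\to(0,\infty)$ and a map $b:X\times X\to[0,\infty)$ with $b(x,y)=b(y,x)$ and $b(x,y)>0$ if and only if $|x-y|=1$ (there is no killing term). $C_c(X)$ denotes the finitely supported functions; $\ell^2(X,m)$ is the space of $f:X\to\mathbb R$ with $\sum_xf(x)^2m(x)<\infty$. For $f:X\to\mathbb R$ the formal Laplacian is $\Delta f(x)=\frac1{m(x)}\sum_yb(x,y)(f(x)-f(y))$. The operator $L_c=\Delta|_{C_c(X)}$, with domain $C_c(X)$, is a symmetric operator on $\ell^2(X,m)$; it is called essentially self-adjoint if it has a unique self-adjoint extension. Neumann semigroup: $Q^{(N)}(f)=\frac12\sum_{x,y}b(x,y)(f(x)-f(y))^2$ with domain all $f\in\ell^2(X,m)$ for which this is finite; $L^{(N)}$ is the associated nonnegative self-adjoint operator on $\ell^2(X,m)$ and $P^{(N)}_t=e^{-tL^{(N)}}$ the Neumann semigroup. Feller property: $C_0(X)$ is the closure of $C_c(X)$ in the supremum norm. The semigroup $P_t$ is Feller if $P_t(C_c(X))\subseteq C_0(X)$ for some (equivalently, all) $t>0$. *)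

(* Defs.v *)
From HB Require Import structures.
From mathcomp Require Import all_boot all_order all_algebra.
From mathcomp Require Import all_classical all_reals all_analysis.

Set Implicit Arguments.
Unset Strict Implicit.
Unset Printing Implicit Defensive.

Import Order.TTheory GRing.Theory Num.Theory.
Import numFieldNormedType.Exports.

Local Open Scope classical_set_scope.
Local Open Scope ring_scope.

Record birth_death_chain (R : realType) (m : nat -> R) (b : nat -> nat -> R)
    : Prop := BirthDeathChain {
  bd_measure_gt0 : forall x, 0 < m x ;
  bd_weight_ge0 : forall x y, 0 <= b x y ;
  bd_weight_sym : forall x y, b x y = b y x ;
  bd_weight_gt0 : forall x y, 0 < b x y <-> `|x%:Z - y%:Z|%N = 1%N
}.

Section Hilbert.
Variables (R : realType) (m : nat -> R).
Implicit Types f g h k : nat -> R.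

Definition Cc : set (nat -> R) := [set f | finite_set [set x | f x != 0]].

Definition C0 : set (nat -> R) :=
  [set f | forall e : R, 0 < e ->
     exists2 phi, Cc phi & forall x, `|f x - phi x| < e].

Definition ell2 : set (nat -> R) :=
  [set f | (\sum_(x <oo) (f x ^+ 2 * m x)%:E < +oo)%E].

(* Only meaningful on ell2, where the series converges absolutely. *)
Definition dot f g : R := limn (series (fun x => f x * g x * m x)).

Definition norm2 f : R := Num.sqrt (dot f f).

Definition ell2_dense (D : set (nat -> R)) : Prop :=
  forall f, ell2 f -> forall e : R, 0 < e ->
    exists2 g, D g & norm2 (fun x => f x - g x) < e.

(* An unbounded operator T on ell2 is identified with its graph, the set of
   pairs (f, T f) with f in the domain of T. As m > 0, two elements of ell2 are
   equal exactly when they are equal as functions. *)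
Definition graph := set ((nat -> R) * (nat -> R)).

Definition domain (T : graph) : set (nat -> R) := [set f | exists g, T (f, g)].

Record linear_operator (T : graph) : Prop := LinearOperator {
  lin_op_ell2 : forall f g, T (f, g) -> ell2 f /\ ell2 g ;
  lin_op_fun : forall f g g', T (f, g) -> T (f, g') -> g = g' ;
  lin_op_0 : T (fun=> 0, fun=> 0) ;
  lin_op_lin : forall (a : R) f g h k, T (f, g) -> T (h, k) ->
    T (fun x => a * f x + h x, fun x => a * g x + k x)
}.

Definition adjoint (T : graph) : graph :=
  [set fg | [/\ ell2 fg.1, ell2 fg.2 &
    forall h k, T (h, k) -> dot k fg.1 = dot h fg.2]].

Definition self_adjoint (T : graph) : Prop :=
  [/\ linear_operator T, ell2_dense (domain T) & adjoint T = T].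

Definition essentially_self_adjoint (T : graph) : Prop :=
  exists! A : graph, self_adjoint A /\ T `<=` A.

(* P is the semigroup e^{-tT}, t >= 0: the strongly continuous semigroup of
   bounded operators on ell2 whose infinitesimal generator is -T. The values of
   P at t < 0 and outside ell2 are irrelevant. *)
Record exp_semigroup (T : graph) (P : R -> (nat -> R) -> nat -> R) : Prop :=
  ExpSemigroup {
  semigroup_ell2 : forall t f, 0 <= t -> ell2 f -> ell2 (P t f) ;
  semigroup_lin : forall t (a : R) f g, 0 <= t -> ell2 f -> ell2 g ->
    P t (fun x => a * f x + g x) = (fun x => a * P t f x + P t g x) ;
  semigroup_bounded : forall t, 0 <= t ->
    exists C : R, forall f, ell2 f -> norm2 (P t f) <= C * norm2 f ;
  semigroup_0 : forall f, ell2 f -> P 0 f = f ;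
  semigroup_add : forall s t f, 0 <= s -> 0 <= t -> ell2 f ->
    P (s + t) f = P s (P t f) ;
  semigroup_cont : forall f, ell2 f ->
    norm2 (fun x => P t f x - f x) @[t --> 0^'+] --> (0 : R) ;
  semigroup_generator : forall f g, T (f, g) <->
    [/\ ell2 f, ell2 g &
      norm2 (fun x => t^-1 * (P t f x - f x) - (- g x)) @[t --> 0^'+]
        --> (0 : R)]
}.

Definition feller (P : R -> (nat -> R) -> nat -> R) : Prop :=
  exists2 t : R, 0 < t & forall f, Cc f -> C0 (P t f).

Variable b : nat -> nat -> R.

Definition formal_laplacian f : nat -> R := fun x =>
  (m x)^-1 * limn (series (fun y => b x y * (f x - f y))).

Definition Lc : graph :=
  [set fg | Cc fg.1 /\ fg.2 = formal_laplacian fg.1].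

Definition neumann_energy f : \bar R :=
  ((2^-1)%:E *
    \sum_(x <oo) \sum_(y <oo) (b x y * (f x - f y) ^+ 2)%:E)%E.

Definition neumann_dom : set (nat -> R) :=
  [set f | ell2 f /\ (neumann_energy f < +oo)%E].

(* The bilinear form polarizing neumann_energy; both series converge absolutely
   for f and g in neumann_dom. *)
Definition neumann_form f g : R :=
  2^-1 * limn (series (fun x =>
    limn (series (fun y => b x y * (f x - f y) * (g x - g y))))).

(* The operator associated with the closed form neumann_form. *)
Definition LN : graph :=
  [set fg | [/\ neumann_dom fg.1, ell2 fg.2 &
    forall h, neumann_dom h -> neumann_form fg.1 h = dot fg.2 h]].

End Hilbert.

(* Main.v *)
Require Import Defs.
From mathcomp Require Import all_boot all_order all_algebra.
From mathcomp Require Import all_classical all_reals all_analysis.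
From mathcomp Require Import zify ring lra.

(** Let [S n] be the sum of [1 / b k k.+1] over [k < n], the function called
    [scale] below: it is harmonic away from [0], and every function [f] on the
    half-line is controlled by [S] and the flux [b k k.+1 * (f k.+1 - f k)],
    whose increments are minus the values of the Laplacian, weighted by [m].
    The theorem follows from two statements about [S].

    If [S] is square-summable, then the Neumann semigroup is not Feller
    ([not_feller]). Testing the form of the Neumann operator L against the
    truncations [S (minn k n)] shows that [`|f n - f 0|] is at most
    [norm2 (L f) * norm2 S] for every [f] in the domain of L
    ([LN_oscillation]); so values far out are controlled by the graph norm.
    Moreover [S] square-summable makes the constant [1] square-summable, and
    the Neumann semigroup P fixes it. Write [1 = g + h] with [g] the indicator
    of a long initial segment. The smoothing estimate
    [norm2 (L (P t h)) <= norm2 h / t] ([semigroup_smoothing]) and the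
    oscillation bound make [P t h] uniformly small, because [norm2 h] is small.
    Hence [P t g = 1 - P t h] stays close to [1] at infinity although [g] is
    finitely supported.

    If [S] is not square-summable, then L_c is essentially self-adjoint
    ([essentially_self_adjoint_scale]). The adjoint of L_c is the maximal
    Laplacian, and it suffices that this be symmetric, i.e. that the boundary
    term of Green's formula vanish at infinity. If it did not, then
    [f ^+ 2 + g ^+ 2] would be bounded below by a multiple of the reciprocal of
    the squared fluxes of [f] and [g]. By Cauchy-Schwarz these squared fluxes
    are at most a multiple of the measure of [0, n] when the total measure is
    infinite, and of the measure of the complement of [0, n] when it is finite;
    in the second case [S] not square-summable forces the fluxes to vanish at
    infinity. In both cases the Abel-Dini argument
    ([sum_le_half_bound]) contradicts square-summability of [f] and [g].

    The semigroup is given only through its strong continuity and its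
    generator. Symmetry, contractivity and the smoothing estimate are derived
    by cutting [0, t] into equal steps and telescoping; this needs that
    [norm2 (P s f) <= M * norm2 f] with [M] uniform for [s] in [0, t], which is
    an instance of the uniform boundedness principle
    ([semigroup_locally_bounded]). *)

Set Implicit Arguments.
Unset Strict Implicit.
Unset Printing Implicit Defensive.

Import Order.TTheory GRing.Theory Num.Theory.
Import numFieldNormedType.Exports.

Local Open Scope classical_set_scope.
Local Open Scope ring_scope.

(** * Square-summable sequences *)

Section Series.
Variable R : realType.
Implicit Types (u v : nat -> R) (C : R).

Lemma series_homo u : (forall k, 0 <= u k) ->
  {homo series u : n p / (n <= p)%N >-> n <= p}.
Proof. by move=> u0 n p np; apply: nondecreasing_series. Qed.

Lemma cvg_series_bounded u C : (forall k, 0 <= u k) ->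
  (forall n, series u n <= C) -> cvgn (series u).
Proof.
move=> u0 uC; apply: nondecreasing_is_cvgn; first exact: series_homo.
by exists C => _ [n _ <-].
Qed.

Lemma series_le_limn u n : (forall k, 0 <= u k) -> cvgn (series u) ->
  series u n <= limn (series u).
Proof. by move=> u0 cu; apply: nondecreasing_cvgn_le => //; exact: series_homo. Qed.

Lemma limn_series_le u C : cvgn (series u) ->
  (forall n, series u n <= C) -> limn (series u) <= C.
Proof. by move=> cu uC; apply: limr_le => //; near=> n; exact: uC.
Unshelve. all: by end_near. Qed.

(** The sets of functions under study are cut out by extended-real series; this
    lets real series carry all computations. *)
Lemma nneseries_ltyP u : (forall k, 0 <= u k) ->
  (\sum_(k <oo) (u k)%:E < +oo)%E <-> cvgn (series u).
Proof.
move=> u0; split=> [ulty|cu].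
  have s0 : (0 <= \sum_(k <oo) (u k)%:E)%E.
    by apply: nneseries_ge0 => k _ _; rewrite lee_fin.
  apply: (@cvg_series_bounded _ (fine (\sum_(k <oo) (u k)%:E)%E)) => // n.
  rewrite -lee_fin fineK ?ge0_fin_numE // /series /= -sumEFin.
  apply: nneseries_lim_ge => k _ _; by rewrite lee_fin.
apply: (@le_lt_trans _ _ (limn (series u))%:E); last exact: ltry.
apply: lime_le.
  by apply: is_cvg_nneseries => k _ _; rewrite lee_fin.
by near=> n; rewrite sumEFin lee_fin; exact: series_le_limn.
Unshelve. all: by end_near. Qed.

End Series.

Section Ell2.
Variables (R : realType) (m : nat -> R).
Hypothesis m_gt0 : forall x, 0 < m x.
Implicit Types (f g h : nat -> R) (a e : R).

Let m_ge0 x : 0 <= m x. Proof. exact: ltW. Qed.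

Let sqrm_ge0 f x : 0 <= f x * f x * m x.
Proof. by rewrite mulr_ge0 // -expr2 sqr_ge0. Qed.

Lemma ell2P f : ell2 m f <-> cvgn (series (fun x => f x * f x * m x)).
Proof.
rewrite -(nneseries_ltyP (sqrm_ge0 f)) /ell2 /=.
by under [X in (X < _)%E <-> _]eq_eseriesr do rewrite expr2.
Qed.

Lemma cvg_series_norm_dot f g : ell2 m f -> ell2 m g ->
  cvgn (series (fun x => `|f x * g x * m x|)).
Proof.
move=> /ell2P cf /ell2P cg.
apply: (@series_le_cvg _ _ (fun x => f x * f x * m x + g x * g x * m x)) => [x|x|x|].
- exact: normr_ge0.
- by rewrite addr_ge0.
- rewrite normrM (ger0_norm (m_ge0 x)) -mulrDl ler_wpM2r // ler_norml.
  by apply/andP; split; nra.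
- exact: is_cvg_seriesD cf cg.
Qed.

Lemma cvg_series_dot f g : ell2 m f -> ell2 m g ->
  cvgn (series (fun x => f x * g x * m x)).
Proof. by move=> hf hg; apply: normed_cvg; exact: cvg_series_norm_dot. Qed.

Lemma ell2_lin a f g : ell2 m f -> ell2 m g -> ell2 m (fun x => a * f x + g x).
Proof.
move=> hf hg; apply/ell2P.
have -> : (fun x => (a * f x + g x) * (a * f x + g x) * m x) =
   (a ^+ 2) *: (fun x => f x * f x * m x) + ((2 * a) *: (fun x => f x * g x * m x)
     + (fun x => g x * g x * m x)).
  by apply/funext => x /=; rewrite !fctE /= /GRing.scale /=; ring.
apply: is_cvg_seriesD; first by apply: is_cvg_seriesZ; exact: cvg_series_dot.
by apply: is_cvg_seriesD; [apply: is_cvg_seriesZ|]; exact: cvg_series_dot.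
Qed.

Lemma ell2_0 : ell2 m (fun=> 0).
Proof.
apply/ell2P; have -> : series (fun x => 0 * 0 * m x) = fun=> 0.
  by apply/funext=> n; rewrite /series /= big1 // => i _; rewrite !mul0r.
exact: is_cvg_cst.
Qed.

Lemma ell2_bounded f g a : ell2 m f -> (forall x, `|g x| <= a * `|f x|) -> ell2 m g.
Proof.
move=> /ell2P cf gf; apply/ell2P.
apply: (@series_le_cvg _ _ ((a ^+ 2) *: (fun x => f x * f x * m x))) => [x|x|x|].
- exact: sqrm_ge0.
- by rewrite mulr_ge0 // sqr_ge0.
- rewrite -[X in _ <= X]/(a ^+ 2 * (f x * f x * m x)) mulrA ler_wpM2r //.
  rewrite -!expr2 -(@real_normK _ (g x)) ?num_real // -(@real_normK _ (f x)) ?num_real //.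
  by rewrite -exprMn lerXn2r ?nnegrE // (le_trans _ (gf x)).
- exact: is_cvg_seriesZ.
Qed.

Lemma dotC f g : dot m f g = dot m g f.
Proof.
by rewrite /dot; congr (limn (series _)); apply/funext => x; rewrite (mulrC (f x)).
Qed.

Lemma dot_linl a f g h : ell2 m f -> ell2 m g -> ell2 m h ->
  dot m (fun x => a * f x + g x) h = a * dot m f h + dot m g h.
Proof.
move=> hf hg hh; rewrite /dot.
have -> : (fun x => (a * f x + g x) * h x * m x) =
   a *: (fun x => f x * h x * m x) + (fun x => g x * h x * m x).
  by apply/funext => x /=; rewrite !fctE /= /GRing.scale /=; ring.
apply/cvg_lim => //; rewrite seriesD seriesZ.
apply: cvgD; last exact: cvg_series_dot.
by apply: cvgZr; exact: cvg_series_dot.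
Qed.

Lemma dot_linr a f g h : ell2 m f -> ell2 m g -> ell2 m h ->
  dot m h (fun x => a * f x + g x) = a * dot m h f + dot m h g.
Proof. by move=> hf hg hh; rewrite dotC dot_linl // dotC (dotC g). Qed.

Lemma ell2Z a f : ell2 m f -> ell2 m (fun x => a * f x).
Proof.
move=> hf; have := ell2_lin a hf ell2_0.
by congr (ell2 m); apply/funext => x; rewrite addr0.
Qed.

Lemma ell2D f g : ell2 m f -> ell2 m g -> ell2 m (fun x => f x + g x).
Proof.
move=> hf hg; have := ell2_lin 1 hf hg.
by congr (ell2 m); apply/funext => x; rewrite mul1r.
Qed.

Lemma ell2B f g : ell2 m f -> ell2 m g -> ell2 m (fun x => f x - g x).
Proof.
move=> hf hg; have := ell2_lin (-1) hg hf.
by congr (ell2 m); apply/funext => x; rewrite mulN1r addrC.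
Qed.

Lemma dot0l f : dot m (fun=> 0) f = 0.
Proof.
rewrite /dot; have -> : series (fun x => 0 * f x * m x) = fun=> 0.
  by apply/funext=> n; rewrite /series /= big1 // => i _; rewrite !mul0r.
exact: lim_cst.
Qed.

Lemma dotZl a f h : ell2 m f -> ell2 m h ->
  dot m (fun x => a * f x) h = a * dot m f h.
Proof.
move=> hf hh; have := dot_linl a hf ell2_0 hh; rewrite dot0l addr0 => <-.
by congr (dot m _ _); apply/funext => x; rewrite addr0.
Qed.

Lemma dotDl f g h : ell2 m f -> ell2 m g -> ell2 m h ->
  dot m (fun x => f x + g x) h = dot m f h + dot m g h.
Proof.
move=> hf hg hh; have := dot_linl 1 hf hg hh; rewrite mul1r => <-.
by congr (dot m _ _); apply/funext => x; rewrite mul1r.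
Qed.

Lemma dotBl f g h : ell2 m f -> ell2 m g -> ell2 m h ->
  dot m (fun x => f x - g x) h = dot m f h - dot m g h.
Proof.
move=> hf hg hh; have := dot_linl (-1) hg hf hh; rewrite mulN1r addrC => <-.
by congr (dot m _ _); apply/funext => x; rewrite mulN1r addrC.
Qed.

Lemma dotBr f g h : ell2 m f -> ell2 m g -> ell2 m h ->
  dot m h (fun x => f x - g x) = dot m h f - dot m h g.
Proof. by move=> hf hg hh; rewrite dotC dotBl // !(dotC h). Qed.

Lemma dotZr a f h : ell2 m f -> ell2 m h ->
  dot m h (fun x => a * f x) = a * dot m h f.
Proof. by move=> hf hh; rewrite dotC dotZl // (dotC f). Qed.

Lemma dot_ge0 f : ell2 m f -> 0 <= dot m f f.
Proof.
move=> /ell2P cf; apply: le_trans (series_le_limn 0 (sqrm_ge0 f) cf).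
by rewrite /series /= big_geq.
Qed.

Lemma series_sqr_le_dot f n : ell2 m f ->
  series (fun x => f x * f x * m x) n <= dot m f f.
Proof. by move=> /ell2P cf; exact: series_le_limn. Qed.

Lemma norm2_ge0 f : 0 <= norm2 m f.
Proof. exact: sqrtr_ge0. Qed.

Lemma sqr_norm2 f : ell2 m f -> norm2 m f ^+ 2 = dot m f f.
Proof. by move=> hf; rewrite sqr_sqrtr // dot_ge0. Qed.

Lemma cauchy_schwarz f g : ell2 m f -> ell2 m g ->
  `|dot m f g| <= norm2 m f * norm2 m g.
Proof.
move=> hf hg.
rewrite -[leLHS]ger0_norm // -ler_sqr ?nnegrE ?mulr_ge0 ?norm2_ge0 //.
rewrite exprMn !sqr_norm2 // ger0_norm // real_normK ?num_real //.
(* The discriminant of this nonnegative quadratic polynomial in [t] is the claim. *)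
have q (t : R) : 0 <= dot m f f - 2 * t * dot m f g + t ^+ 2 * dot m g g.
  have := dot_ge0 (ell2_lin (- t) hg hf).
  rewrite dot_linl ?dot_linr ?(dotC g f) //; last exact: ell2_lin.
  by congr (_ <= _); ring.
have [g0|g0] := eqVneq (dot m g g) 0.
  have [->|fg0] := eqVneq (dot m f g) 0; first by rewrite expr0n /= mulr_ge0 ?dot_ge0.
  have := q ((dot m f f + 1) / (2 * dot m f g)); rewrite g0 mulr0 addr0.
  have -> : 2 * ((dot m f f + 1) / (2 * dot m f g)) * dot m f g = dot m f f + 1.
    by field.
  by rewrite opprD addrA subrr add0r oppr_ge0 ler10.
have gp : 0 < dot m g g by rewrite lt_def g0 dot_ge0.
have := q (dot m f g / dot m g g); rewrite -(pmulr_lge0 _ gp) => Q.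
rewrite -subr_ge0; apply: le_trans Q _; rewrite le_eqVlt; apply/orP; left; apply/eqP.
by field.
Qed.

Lemma norm2D f g : ell2 m f -> ell2 m g ->
  norm2 m (fun x => f x + g x) <= norm2 m f + norm2 m g.
Proof.
move=> hf hg; have hfg := ell2D hf hg.
rewrite -ler_sqr ?nnegrE ?addr_ge0 ?norm2_ge0 // sqr_norm2 //.
rewrite dotDl // !(dotC _ (fun x => _ + _)) !dotDl // (dotC g f).
have := cauchy_schwarz hf hg; rewrite ler_norml => /andP[_ cs].
rewrite sqrrD !sqr_norm2 // mulr2n; lra.
Qed.

Lemma norm2Z a f : ell2 m f -> norm2 m (fun x => a * f x) = `|a| * norm2 m f.
Proof.
move=> hf; rewrite /norm2 dotZl ?dotZr //; last exact: ell2Z.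
by rewrite mulrA -expr2 sqrtrM ?sqr_ge0 // sqrtr_sqr.
Qed.

Lemma norm2N f : norm2 m (fun x => - f x) = norm2 m f.
Proof.
rewrite /norm2 /dot; congr (Num.sqrt (limn (series _))).
by apply/funext => x; rewrite mulrNN.
Qed.

Lemma norm2C f g : norm2 m (fun x => f x - g x) = norm2 m (fun x => g x - f x).
Proof. by rewrite -norm2N; congr norm2; apply/funext => x; rewrite opprB. Qed.

Lemma norm2B f g : ell2 m f -> ell2 m g ->
  norm2 m (fun x => f x - g x) <= norm2 m f + norm2 m g.
Proof.
move=> hf hg; rewrite -(norm2N g); apply: norm2D => //.
by have := ell2Z (-1) hg; congr ell2; apply/funext => x; rewrite mulN1r.
Qed.

Lemma norm2_triangle f g h : ell2 m f -> ell2 m g -> ell2 m h ->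
  norm2 m (fun x => f x - h x) <=
  norm2 m (fun x => f x - g x) + norm2 m (fun x => g x - h x).
Proof.
move=> hf hg hh.
have -> : (fun x => f x - h x) = (fun x => (f x - g x) + (g x - h x)).
  by apply/funext => x; ring.
by apply: norm2D; exact: ell2B.
Qed.

Lemma norm2_0 : norm2 m (fun=> 0) = 0.
Proof. by rewrite /norm2 dot0l sqrtr0. Qed.

Lemma ell2_pointwise f x : ell2 m f -> Num.sqrt (m x) * `|f x| <= norm2 m f.
Proof.
move=> hf; rewrite -ler_sqr ?nnegrE ?mulr_ge0 ?sqrtr_ge0 ?norm2_ge0 //.
rewrite sqr_norm2 // exprMn sqr_sqrtr // real_normK ?num_real //.
apply: le_trans (series_sqr_le_dot x.+1 hf).
rewrite seriesSr -[leLHS]add0r; apply: lerD.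
  by rewrite /series /=; apply: sumr_ge0 => i _; exact: sqrm_ge0.
by rewrite mulrC expr2.
Qed.

Lemma norm2_le f C : 0 <= C ->
  (forall n, series (fun x => f x * f x * m x) n <= C ^+ 2) ->
  ell2 m f /\ norm2 m f <= C.
Proof.
move=> C0 fC.
have hf : ell2 m f by apply/ell2P; exact: cvg_series_bounded fC.
split=> //; rewrite -ler_sqr ?nnegrE ?norm2_ge0 // sqr_norm2 //.
by apply: limn_series_le => //; apply/ell2P.
Qed.

Lemma ell2_tail f e : ell2 m f -> 0 < e -> exists N,
  forall n, (N <= n)%N -> norm2 m (fun x => if (x < n)%N then 0 else f x) < e.
Proof.
move=> hf e0.
have e20 : 0 < (e / 2) ^+ 2 by rewrite exprn_gt0 // divr_gt0.
have /cvgrPdist_lt/(_ _ e20)[N _ NP] := (ell2P f).1 hf.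
exists N => n Nn; apply: (@le_lt_trans _ _ (e / 2)); last first.
  by rewrite ltr_pdivrMr // ltr_pMr // ltr1n.
apply: (norm2_le _ _).2; first by rewrite divr_ge0 // ltW.
move=> p; apply: le_trans (ltW (NP n Nn)).
rewrite ger0_norm ?subr_ge0; last by rewrite -[leLHS]/(series _ n) series_sqr_le_dot.
rewrite lerBrDr; apply: le_trans (series_sqr_le_dot (maxn n p) hf).
rewrite -lerBrDr /series /= (big_cat_nat (leq0n n) (leq_maxl n p)) /= addrAC subrr add0r.
have [np|pn] := leqP n p.
  rewrite (big_cat_nat (leq0n n) np) /= big_nat big1 ?add0r.
    rewrite big_nat [leRHS]big_nat; apply: ler_sum => k /andP[nk _].
    by rewrite ltnNge nk.
  by move=> k /andP[_ ->]; rewrite !mul0r.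
rewrite big_nat big1; first by apply: sumr_ge0 => k _.
by move=> k /andP[_ kp]; rewrite (ltn_trans kp pn) !mul0r.
Qed.

(** Fatou's lemma for the weighted counting measure: every partial sum of the
    squared norm passes to the pointwise limit. *)
Lemma cvg_pointwise_norm2_le (f_ : nat -> nat -> R) f C : 0 <= C ->
  (forall j, ell2 m (f_ j)) ->
  (forall j, norm2 m (f_ j) <= C) ->
  (forall x, f_ j x @[j --> \oo] --> f x) -> ell2 m f /\ norm2 m f <= C.
Proof.
move=> C0 hf_ nf_ cf; apply: norm2_le => // n.
have cs : (fun j => series (fun x => f_ j x * f_ j x * m x) n) @ \oo -->
    series (fun x => f x * f x * m x) n.
  elim: n => [|n IH].
    by under eq_fun do rewrite /series /= big_geq //; rewrite /series /= big_geq //; exact: cvg_cst.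
  under eq_fun do rewrite seriesSr; rewrite seriesSr.
  by apply: cvgD => //; apply: cvgMl; apply: cvgM; exact: cf.
rewrite -(cvg_lim _ cs) //; apply: limr_le; first by apply/cvg_ex; eexists; exact: cs.
near=> j; apply: le_trans (series_sqr_le_dot n (hf_ j)) _.
by rewrite -sqr_norm2 // lerXn2r ?nnegrE ?norm2_ge0.
Unshelve. all: by end_near. Qed.

(** Completeness, for sequences whose steps decrease geometrically. Point
    evaluations are bounded since every point has positive mass, so the limit
    exists pointwise; Fatou's lemma turns it into a limit in norm. *)
Lemma ell2_complete (f_ : nat -> nat -> R) (r : R) : 0 < r < 1 ->
  (forall j, ell2 m (f_ j)) ->
  (forall j, norm2 m (fun x => f_ j.+1 x - f_ j x) <= r ^+ j) ->
  exists2 f, ell2 m f & forall j, norm2 m (fun x => f x - f_ j x) <= r ^+ j / (1 - r).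
Proof.
move=> /andP[r0 r1] hf_ df_.
have r1' : 0 < 1 - r by rewrite subr_gt0.
have step i j : norm2 m (fun x => f_ (i + j)%N x - f_ i x) <=
    r ^+ i * (1 - r ^+ j) / (1 - r).
  elim: j => [|j IH].
    rewrite addn0 expr0 subrr mulr0 mul0r.
    have -> : (fun x => f_ i x - f_ i x) = fun=> 0 by apply/funext => x; rewrite subrr.
    by rewrite norm2_0.
  apply: le_trans (norm2_triangle (hf_ _) (hf_ (i + j)%N) (hf_ _)) _.
  rewrite addnS; apply: le_trans (lerD (df_ _) IH) _.
  rewrite le_eqVlt; apply/orP; left; apply/eqP; rewrite exprD exprS; field.
  by rewrite gt_eqF.
have stepr i j : norm2 m (fun x => f_ (i + j)%N x - f_ i x) <= r ^+ i / (1 - r).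
  apply: le_trans (step i j) _; rewrite ler_pM2r ?invr_gt0 //.
  apply: ler_piMr; first by rewrite exprn_ge0 // ltW.
  by rewrite lerBlDr lerDl exprn_ge0 // ltW.
have cvg_x x : cvgn (fun j => f_ j x).
  have sm : 0 < Num.sqrt (m x) by rewrite sqrtr_gt0.
  have -> : (fun j => f_ j x) =
      series (telescope (fun j => f_ j x)) + cst (f_ 0%N x).
    by rewrite telescopeK; apply/funext => j; rewrite !fctE /= subrK.
  apply: is_cvgD; last exact: is_cvg_cst.
  apply: normed_cvg.
  apply: (@series_le_cvg _ _ (geometric ((Num.sqrt (m x))^-1) r)) => [j|j|j|].
  - exact: normr_ge0.
  - by rewrite /geometric /= mulr_ge0 ?invr_ge0 ?exprn_ge0 ?ltW.
  - rewrite /geometric /= /telescope /= ler_pdivlMl //.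
    apply: le_trans (df_ j); exact: (ell2_pointwise x (ell2B (hf_ j.+1) (hf_ j))).
  - by apply: is_cvg_geometric_series; rewrite ger0_norm // ltW.
pose f x := limn (fun j => f_ j x).
have main j : ell2 m (fun x => f x - f_ j x) /\
    norm2 m (fun x => f x - f_ j x) <= r ^+ j / (1 - r).
  apply: (@cvg_pointwise_norm2_le (fun i x => f_ (j + i)%N x - f_ j x)).
  - by rewrite divr_ge0 ?exprn_ge0 // ltW.
  - by move=> i; exact: ell2B.
  - by move=> i; exact: stepr.
  - move=> x; apply: cvgB; last exact: cvg_cst.
    have := cvg_x x; rewrite -(cvg_shiftn j) /=.
    by under eq_fun do rewrite addnC.
exists f; last by move=> j; exact: (main j).2.
have := ell2D (main 0%N).1 (hf_ 0%N).
by congr ell2; apply/funext => x; rewrite subrK.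
Qed.

End Ell2.

(** * Local boundedness of a strongly continuous semigroup *)

Section RealSequences.
Variable R : realType.
Implicit Types (a A E : nat -> R) (phi : R -> R).

Lemma telescope_le a (c : R) n : (forall j, (j < n)%N -> a j.+1 <= a j + c) ->
  a n <= a 0%N + n%:R * c.
Proof.
elim: n => [|n IH] ac; first by rewrite mul0r addr0.
apply: le_trans (ac n (leqnn _)) _; rewrite -[in leRHS]natr1 mulrDl mul1r addrA lerD2r.
by apply: IH => j jn; apply: ac; exact: ltnW.
Qed.

(** A discrete Taylor estimate. As the second differences [E] decrease, the
    slope [A k - A k.+1] is at least [(N - k)%:R * E N]; summing the slopes
    over [k < N] gives the quadratic gain. *)
Lemma decreasing_convex_le A E N : (forall k, 0 <= A k) ->
  (forall k, A k.+1 <= A k) ->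
  (forall k, A k - 2 * A k.+1 + A k.+2 = E k) ->
  (forall k, 0 <= E k) -> (forall k, E k.+1 <= E k) ->
  N%:R ^+ 2 * E N <= 2 * A 0%N.
Proof.
move=> A0 Ad AE E0 Ed.
have EN k j : E (k + j)%N <= E k.
  elim: j => [|j IH]; first by rewrite addn0.
  by rewrite addnS; exact: le_trans (Ed _) IH.
have slope j k : j%:R * E (k + j)%N <= A k - A k.+1.
  elim: j k => [|j IH] k; first by rewrite mul0r subr_ge0.
  have := IH k.+1; have := AE k; have := EN k j.+1; rewrite addSnnS -natr1.
  set e := E (k + j.+1)%N => *; lra.
have val j k : j%:R ^+ 2 * E (k + j)%N <= 2 * A k.
  elim: j k => [|j IH] k; first by rewrite expr0n /= mul0r mulr_ge0.
  have := IH k.+1; have := slope j.+1 k; rewrite addSnnS -natr1.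
  have := E0 (k + j.+1)%N; set e := E (k + j.+1)%N => *; nra.
by have := val N 0%N.
Qed.

(** Errors that vanish as the step tends to [0] can be made small along a
    subdivision of [0, t] into equal steps. *)
Lemma cvg_mesh phi (t e : R) : phi h @[h --> 0^'+] --> (0 : R) ->
  0 < t -> 0 < e -> exists n : nat, `|phi (t / n.+1%:R)| < e.
Proof.
move=> cphi t0 e0.
have /cvgrPdist_lt/(_ _ e0) H := cphi.
have [d /= d0 dP] := H.
have [n _ nP] : \forall n \near \oo, t / n.+1%:R < d.
  have := @cvg_harmonic R; move/cvgrPdist_lt/(_ (d / t)); rewrite divr_gt0 //.
  move=> /(_ isT); apply: filterS => n /=.
  rewrite sub0r normrN ger0_norm ?invr_ge0 // ltr_pdivlMr //.
  by rewrite mulrC.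
exists n; have /= := dP (t / n.+1%:R).
rewrite !sub0r !normrN; apply; last by rewrite divr_gt0.
by rewrite gtr0_norm ?divr_gt0 //; apply: nP => /=.
Qed.

End RealSequences.

Section Semigroup.
Variables (R : realType) (m : nat -> R).
Hypothesis m_gt0 : forall x, 0 < m x.
Variables (T : graph R) (P : R -> (nat -> R) -> nat -> R).
Hypothesis hP : exp_semigroup m T P.
Implicit Types (f g h k : nat -> R) (s t : R).

Local Notation nrm := (norm2 m).
Local Notation ell2 := (ell2 m).
Local Notation dot := (dot m).

Let Pe t f := @semigroup_ell2 _ _ _ _ hP t f.

Lemma semigroupD t f g : 0 <= t -> ell2 f -> ell2 g ->
  P t (fun x => f x + g x) = (fun x => P t f x + P t g x).
Proof.
move=> t0 hf hg; have := semigroup_lin hP 1 t0 hf hg.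
have -> : (fun x => 1 * f x + g x) = (fun x => f x + g x).
  by apply/funext => x; rewrite mul1r.
by move=> ->; apply/funext => x; rewrite mul1r.
Qed.

Lemma semigroupB t f g : 0 <= t -> ell2 f -> ell2 g ->
  P t (fun x => f x - g x) = (fun x => P t f x - P t g x).
Proof.
move=> t0 hf hg; have := semigroup_lin hP (-1) t0 hg hf.
have -> : (fun x => -1 * g x + f x) = (fun x => f x - g x).
  by apply/funext => x; rewrite mulN1r addrC.
by move=> ->; apply/funext => x; rewrite mulN1r addrC.
Qed.

Lemma semigroup_fun0 t : 0 <= t -> P t (fun=> 0) = fun=> 0.
Proof.
move=> t0; have := semigroupB t0 (ell2_0 m_gt0) (ell2_0 m_gt0).
have -> : (fun=> 0 - 0) = (fun=> 0) :> (nat -> R) by apply/funext => x; rewrite subrr.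
by move=> ->; apply/funext => x; rewrite subrr.
Qed.

Lemma semigroupZ t (a : R) f : 0 <= t -> ell2 f ->
  P t (fun x => a * f x) = (fun x => a * P t f x).
Proof.
move=> t0 hf; have := semigroup_lin hP a t0 hf (ell2_0 m_gt0).
have -> : (fun x => a * f x + 0) = (fun x => a * f x).
  by apply/funext => x; rewrite addr0.
by move=> ->; apply/funext => x; rewrite semigroup_fun0 // addr0.
Qed.

(** A vector at which the operator norm [S] is almost attained. The hump
    argument below needs a factor above [1 / 2], and [3 / 4] will do. *)
Lemma near_norming s K : 0 <= s -> 0 <= K ->
  ~ (forall f, ell2 f -> nrm (P s f) <= K * nrm f) ->
  exists S, [/\ K < S, (forall f, ell2 f -> nrm (P s f) <= S * nrm f) &
    exists2 y, ell2 y /\ nrm y <= 1 & 3 / 4 * S <= nrm (P s y)].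
Proof.
move=> s0 K0 nK; have [C hC] := semigroup_bounded hP s0.
pose B := [set r : R | exists y, [/\ ell2 y, nrm y <= 1 & r = nrm (P s y)]].
have B0 : B 0.
  exists (fun=> 0); split; [exact: ell2_0|by rewrite norm2_0|].
  by rewrite semigroup_fun0 // norm2_0.
have supB : has_sup B.
  split; first by exists 0.
  exists `|C| => _ [y [hy y1 ->]]; apply: le_trans (hC _ hy) _.
  apply: le_trans (ler_norm _) _; rewrite normrM ler_piMr //.
  by rewrite ger0_norm // norm2_ge0.
pose S := sup B.
have SP f : ell2 f -> nrm (P s f) <= S * nrm f.
  move=> hf; have [f0|f0] := eqVneq (nrm f) 0.
    by have := hC _ hf; rewrite f0 !mulr0.
  have fp : 0 < nrm f by rewrite lt_def f0 norm2_ge0.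
  have : B ((nrm f)^-1 * nrm (P s f)).
    exists (fun x => (nrm f)^-1 * f x); split; first exact: ell2Z.
      by rewrite norm2Z // ger0_norm ?invr_ge0 ?norm2_ge0 // mulVf.
    rewrite semigroupZ // norm2Z // ?ger0_norm ?invr_ge0 ?norm2_ge0 //.
    exact: Pe.
  move=> /(ub_le_sup supB.2); rewrite ler_pdivrMl // mulrC.
  by rewrite mulrC.
have KS : K < S.
  rewrite ltNge; apply/negP => SK; apply: nK => f hf; apply: le_trans (SP f hf) _.
  by rewrite ler_wpM2r // norm2_ge0.
exists S; split=> //.
have e0 : 0 < S / 4 by rewrite divr_gt0 // (le_lt_trans K0 KS).
have [_ [y [hy y1 ->]] yS] := sup_adherent e0 supB.
exists y => //; rewrite -/S in yS; lra.
Qed.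

(** The uniform boundedness principle, by a gliding hump. If [P s] were
    unbounded for [s] near [0], choose times [s_ n] tending to [0] with operator
    norm above [4 * n * 3 ^ n], and add or subtract at stage [n] a vector of
    size at most [3 ^ - n] that almost norms [P (s_ n)]. The later stages are
    too small to cancel this hump, so [P (s_ n)] is unbounded at the limit
    vector, against strong continuity at [0]. *)
Lemma semigroup_bounded_near0 : exists M d : R, 0 < d /\
  forall s f, 0 <= s <= d -> ell2 f -> nrm (P s f) <= M * nrm f.
Proof.
apply: contrapT => nB.
pose K n : R := 4 * n%:R * 3 ^+ n.
have K0 n : 0 <= K n by rewrite !mulr_ge0 // exprn_ge0.
have H n : exists w : R * R * (nat -> R), let: (s, Sn, y) := w in
  [/\ 0 <= s <= n.+1%:R^-1, K n < Sn,
    (forall f, ell2 f -> nrm (P s f) <= Sn * nrm f),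
    ell2 y /\ nrm y <= 1 & 3 / 4 * Sn <= nrm (P s y)].
  apply: contrapT => nH; apply: nB; exists (K n), n.+1%:R^-1; split.
    by rewrite invr_gt0.
  move=> s f sn hf; apply: contrapT => nsf.
  have s0 : 0 <= s by case/andP: sn.
  have [|Sn [KS hS [y hy yS]]] := @near_norming s (K n) s0 (K0 n).
    by move=> /(_ f hf).
  by apply: nH; exists (s, Sn, y).
have [w hw] := choice H.
pose s_ n := (w n).1.1; pose S_ n := (w n).1.2; pose y_ n := (w n).2.
have {hw} hw n : [/\ 0 <= s_ n <= n.+1%:R^-1, K n < S_ n,
    (forall f, ell2 f -> nrm (P (s_ n) f) <= S_ n * nrm f),
    ell2 (y_ n) /\ nrm (y_ n) <= 1 & 3 / 4 * S_ n <= nrm (P (s_ n) (y_ n))].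
  by have := hw n; rewrite /s_ /S_ /y_; case: (w n) => [[]].
pose u n := fun x => (3^-1) ^+ n * y_ n x.
have u_ell2 n : ell2 (u n) by apply: ell2Z; have [_ _ _ []] := hw n.
pose step n (x : nat -> R) : nat -> R :=
  if nrm (P (s_ n) (u n)) <= nrm (P (s_ n) (fun i => x i + u n i))
  then (fun i => x i + u n i) else (fun i => x i - u n i).
have step_ell2 n x : ell2 x -> ell2 (step n x).
  by move=> hx; rewrite /step; case: ifP => _; [apply: ell2D|apply: ell2B].
have s0 n : 0 <= s_ n by have [/andP[]] := hw n.
(* [2 u = (x + u) - (x - u)], so one of the two signs does not shrink the image. *)
have step_big n x : ell2 x -> nrm (P (s_ n) (u n)) <= nrm (P (s_ n) (step n x)).
  move=> hx; rewrite /step; case: ifPn => //; rewrite -ltNge => lt.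
  have := norm2B m_gt0 (Pe (s0 n) (ell2D m_gt0 hx (u_ell2 n)))
                       (Pe (s0 n) (ell2B m_gt0 hx (u_ell2 n))).
  rewrite -semigroupB //; try exact: ell2D; try exact: ell2B.
  have -> : (fun i => x i + u n i - (x i - u n i)) = (fun i => 2 * u n i).
    by apply/funext => i; ring.
  rewrite semigroupZ // norm2Z //; last exact: Pe.
  rewrite ger0_norm //; lra.
pose fix x_ n : nat -> R := if n is n'.+1 then step n' (x_ n') else fun=> 0.
have x_ell2 n : ell2 (x_ n).
  by elim: n => [|n IH] /=; [exact: ell2_0 | exact: step_ell2].
have u_norm n : nrm (u n) <= (3^-1) ^+ n.
  have [_ _ _ [hy y1] _] := hw n.
  rewrite norm2Z // ger0_norm ?exprn_ge0 ?invr_ge0 //.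
  by rewrite ler_piMr // exprn_ge0 // invr_ge0.
have x_step n : nrm (fun i => x_ n.+1 i - x_ n i) <= (3^-1) ^+ n.
  apply: le_trans (u_norm n); rewrite /= /step; case: ifP => _.
    by have -> : (fun i => x_ n i + u n i - x_ n i) = u n by apply/funext => i; ring.
  have -> : (fun i => x_ n i - u n i - x_ n i) = (fun i => - u n i).
    by apply/funext => i; ring.
  by rewrite norm2N.
have [|x hx xlim] := ell2_complete m_gt0 _ x_ell2 x_step; first by lra.
have big n : n%:R <= nrm (P (s_ n) x).
  have [_ KS hS [hy y1] yS] := hw n.
  have h1 := step_big n _ (x_ell2 n).
  have h2 : 3 / 4 * S_ n * (3^-1) ^+ n <= nrm (P (s_ n) (u n)).
    rewrite semigroupZ // norm2Z //; last exact: Pe.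
    by rewrite ger0_norm ?exprn_ge0 ?invr_ge0 // mulrC ler_wpM2l ?exprn_ge0 ?invr_ge0.
  have h3 := hS _ (ell2B m_gt0 hx (x_ell2 n.+1)).
  have h4 := norm2_triangle m_gt0 (Pe (s0 n) (x_ell2 n.+1)) (Pe (s0 n) hx) (ell2_0 m_gt0).
  have e0 (f : nat -> R) : (fun i => f i - 0) = f by apply/funext => i; rewrite subr0.
  rewrite !e0 (norm2C m (P (s_ n) (x_ n.+1))) -semigroupB // in h4.
  have Sp : 0 <= S_ n by apply: le_trans (ltW KS).
  have h5 := ler_wpM2l Sp (xlim n.+1).
  (* The hump contributes [3 / 4] of [S_ n * 3 ^ - n], and the tail of the
     geometric series takes back at most [1 / 2] of it. *)
  have e1 : S_ n * (3^-1 ^+ n.+1 / (1 - 3^-1)) = S_ n * (3^-1) ^+ n / 2.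
    by rewrite exprS; field.
  rewrite e1 in h5.
  have h6 : 4 * n%:R <= S_ n * (3^-1) ^+ n.
    rewrite exprVn ler_pdivlMr ?exprn_gt0 //; exact: ltW.
  rewrite -[step n _]/(x_ n.+1) in h1.
  lra.
have /cvgrPdist_lt/(_ _ ltr01)[d /= d0 dP] := semigroup_cont hP hx.
have bnd s : 0 <= s < d -> nrm (P s x) <= nrm x + 1.
  move=> /andP[]; rewrite le_eqVlt => /predU1P[<-|sp] sd.
    by rewrite (semigroup_0 hP hx) lerDl.
  have := dP s; rewrite /= !sub0r !normrN (gtr0_norm sp) ger0_norm ?norm2_ge0 //.
  move=> /(_ sd sp) /ltW h.
  have -> : P s x = fun i => x i + (P s x i - x i) by apply/funext => i; ring.
  have hs := Pe (ltW sp) hx.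
  apply: le_trans (norm2D m_gt0 hx (ell2B m_gt0 hs hx)) _.
  by rewrite lerD2l.
have [n /andP[nd nx]] : exists n : nat, (n.+1%:R^-1 < d) && (nrm x + 1 < n%:R).
  have [n1 _ n1P] : \forall n \near \oo, n.+1%:R^-1 < d.
    have := @cvg_harmonic R; move/cvgrPdist_lt/(_ d d0); apply: filterS => n /=.
    by rewrite sub0r normrN ger0_norm ?invr_ge0.
  exists (maxn n1 (Num.bound (nrm x + 1))); apply/andP; split.
    by apply: n1P => /=; exact: leq_maxl.
  apply: (@lt_le_trans _ _ (Num.bound (nrm x + 1))%:R).
    by apply: archi_boundP; rewrite addr_ge0 ?norm2_ge0.
  by rewrite ler_nat leq_maxr.
have [/andP[_ sn] _ _ _ _] := hw n.
have := bnd (s_ n); rewrite s0 (le_lt_trans sn nd) => /(_ isT).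
by move/(le_trans (big n)); rewrite leNgt nx.
Qed.

Lemma semigroup_locally_bounded t : exists2 M : R, 0 <= M &
  forall s f, 0 <= s <= t -> ell2 f -> nrm (P s f) <= M * nrm f.
Proof.
have [M [d [d0 hM]]] := semigroup_bounded_near0.
have H n : exists2 M' : R, 0 <= M' &
    forall s f, 0 <= s <= n.+1%:R * d -> ell2 f -> nrm (P s f) <= M' * nrm f.
  elim: n => [|n [M' M'0 IH]].
    exists `|M| => // s f; rewrite mul1r => sd hf; apply: le_trans (hM s f sd hf) _.
    by rewrite ler_wpM2r ?norm2_ge0 ?ler_norm.
  exists (Num.max M' (`|M| * M')) => [|s f /andP[s0 sn] hf].
    by rewrite le_max M'0.
  have [sd|sd] := leP s (n.+1%:R * d).
    apply: le_trans (IH s f _ hf) _; first by rewrite s0.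
    by rewrite ler_wpM2r ?norm2_ge0 // le_max lexx.
  have dn : d <= n.+1%:R * d by rewrite ler_peMl ?(ltW d0) // ler1n.
  have sd0 : 0 <= s - d by lra.
  have -> : s = d + (s - d) by ring.
  rewrite (semigroup_add hP (ltW d0) sd0 hf).
  apply: le_trans (hM _ _ _ (Pe sd0 hf)) _; first by rewrite lexx ltW.
  apply: (@le_trans _ _ (`|M| * nrm (P (s - d) f))).
    by rewrite ler_wpM2r ?norm2_ge0 ?ler_norm.
  apply: (@le_trans _ _ (`|M| * (M' * nrm f))).
    rewrite ler_wpM2l //; apply: IH => //; rewrite sd0 /=.
    by rewrite -natr1 mulrDl mul1r in sn; lra.
  by rewrite mulrA ler_wpM2r ?norm2_ge0 // le_max lexx orbT.
have [M' M'0 HM] := H (Num.bound (`|t| / d)).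
exists M' => // s f /andP[s0 st]; apply: HM; rewrite s0 /=.
apply: le_trans st _; apply: le_trans (ler_norm t) _.
rewrite -ler_pdivrMr //; apply: le_trans (ltW (archi_boundP _)) _.
  by rewrite divr_ge0 // ltW.
by rewrite ler_nat.
Qed.

End Semigroup.

(** * Semigroups generated by nonnegative symmetric operators *)

Section Generator.
Variables (R : realType) (m : nat -> R).
Hypothesis m_gt0 : forall x, 0 < m x.
Variables (T : graph R) (P : R -> (nat -> R) -> nat -> R).
Hypothesis hP : exp_semigroup m T P.
Implicit Types (f g h k : nat -> R) (s t : R).

Local Notation nrm := (norm2 m).
Local Notation ell2 := (ell2 m).
Local Notation dot := (dot m).

Let Pe t f := @semigroup_ell2 _ _ _ _ hP t f.

Lemma generator_ell2 f g : T (f, g) -> ell2 f /\ ell2 g.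
Proof. by case/(semigroup_generator hP). Qed.

Lemma norm2Zp (a : R) f : 0 < a -> ell2 f -> a * nrm f = nrm (fun x => a * f x).
Proof. by move=> a0 hf; rewrite norm2Z // gtr0_norm. Qed.

Definition quotient_error f g (h : R) : R :=
  nrm (fun x => h^-1 * (P h f x - f x) - (- g x)).

(** The first-order Taylor remainder of the orbit of [f] at time [0]; it is
    [o(h)] when [T (f, g)], since the generator is [- T]. *)
Definition remainder f g (h : R) : nat -> R := fun x => P h f x - f x + h * g x.

Lemma ell2_remainder f g (h : R) : T (f, g) -> 0 < h -> ell2 (remainder f g h).
Proof.
move=> /generator_ell2[hf hg] h0; apply: ell2D => //; last exact: ell2Z.
by apply: ell2B => //; apply: Pe => //; exact: ltW.
Qed.

Lemma norm2_remainder f g (h : R) : T (f, g) -> 0 < h ->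
  nrm (remainder f g h) = h * quotient_error f g h.
Proof.
move=> fg h0; have [hf hg] := generator_ell2 fg.
have hq : ell2 (fun x => h^-1 * (P h f x - f x) - (- g x)).
  apply: ell2B => //; last first.
    by have := ell2Z m_gt0 (-1) hg; congr ell2; apply/funext => x; rewrite mulN1r.
  by apply: ell2Z => //; apply: ell2B => //; apply: Pe => //; exact: ltW.
rewrite /quotient_error norm2Zp //; congr norm2.
by apply/funext => x; rewrite /remainder; field; rewrite gt_eqF.
Qed.

Lemma cvg_quotient_error f g : T (f, g) ->
  quotient_error f g h @[h --> 0^'+] --> (0 : R).
Proof. by case/(semigroup_generator hP). Qed.

Lemma generatorB f g h k : T (f, g) -> T (h, k) ->
  T (fun x => f x - h x, fun x => g x - k x).
Proof.
move=> fg hk; have [hf hg] := generator_ell2 fg; have [hh hk'] := generator_ell2 hk.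
apply/(semigroup_generator hP); split; [exact: ell2B|exact: ell2B|].
apply: (@squeeze_cvgr _ _ _ _ (fun=> 0)
    (fun t => quotient_error f g t + quotient_error h k t)).
- near=> t; rewrite norm2_ge0 /=.
  have t0 : 0 < t by near: t; exact: nbhs_right_gt.
  rewrite -(ler_pM2l t0) mulrDr -(norm2_remainder fg t0) -(norm2_remainder hk t0).
  rewrite norm2Zp //; last first.
    apply: ell2B => //; first apply: ell2Z => //.
      by apply: ell2B => //; [apply: Pe; [exact: ltW|]|]; exact: ell2B.
    have := ell2B m_gt0 hk' hg; congr ell2; apply/funext => x.
    by rewrite opprB.
  apply: le_trans (norm2B m_gt0 (ell2_remainder fg t0) (ell2_remainder hk t0)).
  rewrite le_eqVlt; apply/orP; left; apply/eqP; congr norm2; apply/funext => x.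
  rewrite (semigroupB hP (ltW t0) hf hh) /remainder; field.
  by rewrite gt_eqF.
- exact: cvg_cst.
- rewrite -[X in _ --> X]addr0.
  by apply: cvgD; exact: cvg_quotient_error.
Unshelve. all: by end_near. Qed.

Lemma semigroup_commute s t f : 0 <= s -> 0 <= t -> ell2 f -> P s (P t f) = P t (P s f).
Proof. by move=> s0 t0 hf; rewrite -!(semigroup_add hP) // addrC. Qed.

(** [P s] commutes with the difference quotients of the orbit, and it is
    bounded, so it preserves the domain and commutes with the generator. *)
Lemma semigroup_domain s f g : 0 <= s -> T (f, g) -> T (P s f, P s g).
Proof.
move=> s0 fg; have [hf hg] := generator_ell2 fg.
apply/(semigroup_generator hP); split; [exact: Pe|exact: Pe|].
have [C hC] := semigroup_bounded hP s0.
apply: (@squeeze_cvgr _ _ _ _ (fun=> 0) (fun t => C * quotient_error f g t)).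
- near=> t; rewrite norm2_ge0 /=.
  have t0 : 0 < t by near: t; exact: nbhs_right_gt.
  have hd : ell2 (fun x => P t f x - f x) by apply: ell2B => //; apply: Pe => //; exact: ltW.
  have hq : ell2 (fun x => t^-1 * (P t f x - f x)) by exact: ell2Z.
  have hn : ell2 (fun x => - g x).
    by have := ell2Z m_gt0 (-1) hg; congr ell2; apply/funext => x; rewrite mulN1r.
  have <- : P s (fun x => t^-1 * (P t f x - f x) - (- g x)) =
    (fun x => t^-1 * (P t (P s f) x - P s f x) - - P s g x).
    rewrite (semigroupB hP s0 hq hn) (semigroupZ m_gt0 hP _ s0 hd).
    rewrite (semigroupB hP s0 (Pe (ltW t0) hf) hf) (semigroup_commute s0 (ltW t0)) //.
    have -> : (fun x => - g x) = (fun x => -1 * g x) by apply/funext=> x; rewrite mulN1r.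
    by rewrite (semigroupZ m_gt0 hP _ s0 hg); apply/funext => x; rewrite mulN1r.
  by apply: hC; exact: ell2B.
- exact: cvg_cst.
- rewrite -[X in _ --> X](mulr0 C); apply: cvgMr; exact: cvg_quotient_error.
Unshelve. all: by end_near. Qed.

Lemma norm2_eq0 f : ell2 f -> nrm f <= 0 -> f = fun=> 0.
Proof.
move=> hf f0; apply/funext => x; apply/eqP; rewrite -normr_le0.
have sm : 0 < Num.sqrt (m x) by rewrite sqrtr_gt0.
by rewrite -(pmulr_rle0 _ sm); apply: le_trans f0; exact: ell2_pointwise.
Qed.

Lemma semigroup_step s (e : R) f g : 0 <= s -> 0 < e -> T (f, g) ->
  P (s + e) f = (fun x => P s f x - e * P s g x + P s (remainder f g e) x).
Proof.
move=> s0 e0 fg; have [hf hg] := generator_ell2 fg.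
have hr := ell2_remainder fg e0.
rewrite (semigroup_add hP s0 (ltW e0) hf).
have {1}-> : P e f = (fun x => f x - e * g x + remainder f g e x).
  by apply/funext => x; rewrite /remainder; ring.
rewrite (semigroupD hP s0 _ hr); last by apply: ell2B => //; exact: ell2Z.
by rewrite (semigroupB hP s0 hf (ell2Z m_gt0 _ hg)) (semigroupZ m_gt0 hP _ s0 hg).
Qed.

Lemma mesh_point (t : R) (n j : nat) : 0 <= t -> (j <= n.+1)%N ->
  0 <= j%:R * (t / n.+1%:R) <= t.
Proof.
move=> t0 jn; apply/andP; split; first by rewrite mulr_ge0 // divr_ge0.
by rewrite mulrCA; apply: ler_piMr => //; rewrite ler_pdivrMr // mul1r ler_nat.
Qed.

Hypothesis T_sym : forall f g h k, T (f, g) -> T (h, k) -> dot g h = dot f k.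
Hypothesis T_ge0 : forall f g, T (f, g) -> 0 <= dot g f.

(** Along [s |-> dot (P s f) (P (t - s) h)] the first-order terms cancel by
    symmetry of the generator, so a step of length [e] changes the value by
    [o(e)], uniformly in [s]; the sum of the [t / e] changes tends to [0]. *)
Lemma semigroup_sym t f g h k : 0 <= t -> T (f, g) -> T (h, k) ->
  dot (P t f) h = dot f (P t h).
Proof.
rewrite le_eqVlt => /predU1P[<-|t0] fg hk;
  have [hf hg] := generator_ell2 fg; have [hh hk'] := generator_ell2 hk.
  by rewrite !(semigroup_0 hP).
apply/eqP; rewrite -subr_eq0 -normr_le0; apply/ler_addgt0Pl => d d0; rewrite addr0.
have [M M0 hM] := semigroup_locally_bounded m_gt0 hP t.
pose phi e := M ^+ 2 * (nrm h * quotient_error f g e + nrm f * quotient_error h k e).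
have cphi : phi e @[e --> 0^'+] --> (0 : R).
  rewrite /phi -[X in _ --> X](mulr0 (M ^+ 2)); apply: cvgMr.
  rewrite -[X in _ --> X]addr0; apply: cvgD.
    by rewrite -[X in _ --> X](mulr0 (nrm h)); apply: cvgMr; exact: cvg_quotient_error.
  by rewrite -[X in _ --> X](mulr0 (nrm f)); apply: cvgMr; exact: cvg_quotient_error.
have dt0 : 0 < d / t by rewrite divr_gt0.
have [n /ltW phin] := cvg_mesh cphi t0 dt0.
set e := t / n.+1%:R in phin.
have e0 : 0 < e by rewrite divr_gt0.
pose a j := dot (P (j%:R * e) f) (P (t - j%:R * e) h).
have step j : (j <= n)%N -> `|a j.+1 - a j| <= e * phi e.
  move=> jn; have /andP[s0 st] := mesh_point (ltW t0) (leq_trans jn (leqnSn n)).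
  have /andP[s'0 s't] : 0 <= j.+1%:R * e <= t by exact: (@mesh_point t n j.+1 (ltW t0) jn).
  rewrite -/e in s0 st; rewrite /a.
  set s := j%:R * e in s0 st *; set r := t - j.+1%:R * e.
  have se : j.+1%:R * e = s + e by rewrite -natr1 mulrDl mul1r.
  have re : t - s = r + e by rewrite /r se; ring.
  have r0 : 0 <= r by rewrite /r subr_ge0.
  have rt : r <= t by rewrite /r gerBl.
  rewrite se re (semigroup_step r0 e0 hk) (semigroup_step s0 e0 fg).
  have hrf := ell2_remainder fg e0; have hrh := ell2_remainder hk e0.
  have [[A1 A2] [A3 A4]] := (generator_ell2 (semigroup_domain s0 fg),
    generator_ell2 (semigroup_domain r0 hk)).
  have A5 := Pe s0 hrf; have A6 := Pe r0 hrh.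
  have A7 := ell2B m_gt0 A1 (ell2Z m_gt0 e A2); have A8 := ell2B m_gt0 A3 (ell2Z m_gt0 e A4).
  rewrite dotDl // dotBl //; last exact: ell2Z.
  rewrite [X in _ - X]dotC dotDl // dotBl //; last exact: ell2Z.
  rewrite !dotZl // (T_sym (semigroup_domain s0 fg) (semigroup_domain r0 hk)).
  rewrite (dotC _ (P r h) (P s f)) (dotC _ (P r k) (P s f)) (dotC _ _ (P s f)).
  set p := dot (P s (remainder f g e)) (P r h).
  set q := dot (P s f) (P r (remainder h k e)).
  rewrite (_ : _ - _ = p - q); last by ring.
  apply: le_trans (ler_normB _ _) _.
  have hs (u : nat -> R) : ell2 u -> nrm (P s u) <= M * nrm u.
    by apply: hM; rewrite s0.
  have hr (u : nat -> R) : ell2 u -> nrm (P r u) <= M * nrm u.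
    by apply: hM; rewrite r0.
  have B1 : `|p| <= M * (e * quotient_error f g e) * (M * nrm h).
    apply: le_trans (cauchy_schwarz m_gt0 A5 A3) _.
    rewrite -norm2_remainder //; apply: ler_pM; rewrite ?norm2_ge0 //; [exact: hs|exact: hr].
  have B2 : `|q| <= M * nrm f * (M * (e * quotient_error h k e)).
    apply: le_trans (cauchy_schwarz m_gt0 A1 A6) _.
    rewrite -norm2_remainder //; apply: ler_pM; rewrite ?norm2_ge0 //; [exact: hs|exact: hr].
  apply: le_trans (lerD B1 B2) _.
  by rewrite le_eqVlt; apply/orP; left; apply/eqP; rewrite /phi; ring.
have a0 : a 0%N = dot f (P t h).
  by rewrite /a mul0r subr0 (semigroup_0 hP).
have ne : n.+1%:R * e = t by rewrite /e mulrCA divff ?mulr1 // pnatr_eq0.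
have an : a n.+1 = dot (P t f) h.
  by rewrite /a ne subrr (semigroup_0 hP).
rewrite -a0 -an.
have := @telescope_le R (fun j => `|a j - a 0%N|) (e * phi e) n.+1.
rewrite subrr normr0 add0r mulrA ne => H; apply: le_trans (H _) _.
  move=> j jn; have -> : a j.+1 - a 0%N = (a j - a 0%N) + (a j.+1 - a j) by ring.
  by apply: le_trans (ler_normD _ _) _; rewrite lerD2l; exact: step.
rewrite mulrC -ler_pdivlMr //; apply: le_trans phin; exact: ler_norm.
Qed.

Lemma cvg_semigroup_defect g : ell2 g ->
  nrm (fun x => g x - P e g x) @[e --> 0^'+] --> (0 : R).
Proof. by move=> /(semigroup_cont hP); under eq_fun do rewrite norm2C. Qed.

(** A backward Euler comparison: up to [o(e)], [P s f] equals [v + e * w] with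
    [v = P (s + e) f] and [T (v, w)], and adding [e * w] to [v] cannot decrease
    the norm as [dot w v] is nonnegative. *)
Lemma semigroup_contraction t f g : 0 <= t -> T (f, g) -> nrm (P t f) <= nrm f.
Proof.
rewrite le_eqVlt => /predU1P[<-|t0] fg; have [hf hg] := generator_ell2 fg.
  by rewrite (semigroup_0 hP).
apply/ler_addgt0Pr => d d0.
have [M M0 hM] := semigroup_locally_bounded m_gt0 hP t.
pose phi e := M * (quotient_error f g e + nrm (fun x => g x - P e g x)).
have cphi : phi e @[e --> 0^'+] --> (0 : R).
  rewrite /phi -[X in _ --> X](mulr0 M); apply: cvgMr.
  rewrite -[X in _ --> X]addr0; apply: cvgD; first exact: cvg_quotient_error.
  exact: cvg_semigroup_defect.
have dt0 : 0 < d / t by rewrite divr_gt0.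
have [n /ltW phin] := cvg_mesh cphi t0 dt0.
set e := t / n.+1%:R in phin.
have e0 : 0 < e by rewrite divr_gt0.
have ne : n.+1%:R * e = t by rewrite /e mulrCA divff ?mulr1 // pnatr_eq0.
pose a j := nrm (P (j%:R * e) f).
have step j : (j <= n)%N -> a j.+1 <= a j + e * phi e.
  move=> jn; have /andP[s0 st] := mesh_point (ltW t0) (leq_trans jn (leqnSn n)).
  rewrite -/e in s0 st; rewrite /a.
  set s := j%:R * e in s0 st *.
  have -> : j.+1%:R * e = s + e by rewrite -natr1 mulrDl mul1r.
  have hge := ell2B m_gt0 hg (Pe (ltW e0) hg).
  have hr := ell2_remainder fg e0.
  pose v := P (s + e) f; pose w := P (s + e) g.
  have se0 : 0 <= s + e by rewrite addr_ge0 // ltW.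
  have vw : T (v, w) by exact: semigroup_domain.
  have [hv hw] := generator_ell2 vw.
  pose r := fun x => e * (g x - P e g x) - remainder f g e x.
  have hr' : ell2 r by apply: ell2B => //; exact: ell2Z.
  have -> : P (s + e) f = v by [].
  have vE : (fun x => v x + e * w x) = (fun x => P s f x - P s r x).
    rewrite /v /w (semigroup_step s0 e0 fg) (semigroup_add hP s0 (ltW e0) hg).
    rewrite (semigroupB hP s0 (ell2Z m_gt0 e hge) hr) (semigroupZ m_gt0 hP _ s0 hge).
    by rewrite (semigroupB hP s0 hg (Pe (ltW e0) hg)); apply/funext => x; ring.
  have v_le : nrm v <= nrm (fun x => v x + e * w x).
    have hew := ell2Z m_gt0 e hw.
    rewrite -ler_sqr ?nnegrE ?norm2_ge0 // !sqr_norm2 //; last exact: ell2D.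
    rewrite dotDl //; last exact: ell2D.
    rewrite 2!(dotC _ _ (fun x => v x + _)) !dotDl // (dotC _ v) !dotZl //.
    have := T_ge0 vw; have := dot_ge0 m_gt0 hew; rewrite dotZl // => A B.
    have : 0 <= e * dot w v by rewrite mulr_ge0 // ltW.
    lra.
  apply: le_trans v_le _; rewrite vE.
  apply: le_trans (norm2B m_gt0 (Pe s0 hf) (Pe s0 hr')) _; rewrite lerD2l.
  apply: le_trans (hM s r _ hr') _; first by rewrite s0.
  rewrite /phi mulrCA ler_wpM2l // mulrDr -norm2_remainder // norm2Zp //.
  by rewrite addrC; apply: norm2B => //; exact: ell2Z.
have := @telescope_le R a (e * phi e) n.+1 step.
rewrite /a mul0r ne (semigroup_0 hP) // => H; apply: le_trans H _.
rewrite lerD2l mulrA ne mulrC -ler_pdivlMr //; apply: le_trans phin; exact: ler_norm.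
Qed.

Lemma semigroup_fixed f t : 0 <= t -> T (f, fun=> 0) -> P t f = f.
Proof.
rewrite le_eqVlt => /predU1P[<-|t0] fg; have [hf _] := generator_ell2 fg.
  by rewrite (semigroup_0 hP).
suff : (fun x => P t f x - f x) = fun=> 0.
  by move=> /funeqP h; apply/funext => x; apply/eqP; rewrite -subr_eq0; apply/eqP; exact: h.
apply: norm2_eq0; first by apply: ell2B => //; apply: Pe => //; exact: ltW.
apply/ler_addgt0Pr => d d0; rewrite add0r.
have dt0 : 0 < d / t by rewrite divr_gt0.
have [n /ltW phin] := cvg_mesh (cvg_quotient_error fg) t0 dt0.
set e := t / n.+1%:R in phin.
have e0 : 0 < e by rewrite divr_gt0.
have ne : n.+1%:R * e = t by rewrite /e mulrCA divff ?mulr1 // pnatr_eq0.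
set q := quotient_error _ _ _ in phin.
pose a j := nrm (fun x => P (j%:R * e) f x - f x).
have step j : (j < n.+1)%N -> a j.+1 <= a j + e * q.
  move=> jn; have s0 : 0 <= j%:R * e by rewrite mulr_ge0 // ltW.
  have s1 : 0 <= j.+1%:R * e by rewrite mulr_ge0 // ltW.
  rewrite /a addrC.
  apply: le_trans (norm2_triangle m_gt0 (Pe s1 hf) (Pe s0 hf) hf) _; rewrite lerD2r.
  have -> : j.+1%:R * e = e + j%:R * e by rewrite -natr1 mulrDl mul1r addrC.
  rewrite (semigroup_add hP (ltW e0) s0) // (semigroup_commute (ltW e0) s0) //.
  rewrite -(semigroupB hP s0 (Pe (ltW e0) hf) hf) -norm2_remainder //.
  have -> : remainder f (fun=> 0) e = (fun x => P e f x - f x).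
    by apply/funext => x; rewrite /remainder mulr0 addr0.
  exact: semigroup_contraction s0 (generatorB (semigroup_domain (ltW e0) fg) fg).
have := @telescope_le R a (e * q) n.+1 step.
rewrite /a mul0r ne (semigroup_0 hP) // mulrA ne.
have -> : (fun x => f x - f x) = fun=> 0 by apply/funext => x; rewrite subrr.
rewrite norm2_0 // add0r => H; apply: le_trans H _.
by rewrite mulrC -ler_pdivlMr //; apply: le_trans phin; exact: ler_norm.
Qed.

(** The bound [norm2 (T (P t f)) <= norm2 f / t] for a nonnegative symmetric
    generator, without spectral calculus. With [e = t / n.+1] and
    [u k = P (k * e) f], symmetry identifies the second differences of
    [norm2 (u k) ^+ 2] with [norm2 (u k - u k.+2) ^+ 2], which decrease by
    contractivity. The discrete Taylor estimate then bounds the last one by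
    [2 * norm2 f ^+ 2 / n.+1 ^ 2], that is, the difference quotient of the orbit
    at time [t] with step [2 * e] by [norm2 f / t]. *)
Lemma semigroup_smoothing t f g : 0 < t -> T (f, g) -> nrm (P t g) <= nrm f / t.
Proof.
move=> t0 fg; have [hf hg] := generator_ell2 fg.
have tg : T (P t f, P t g) by apply: semigroup_domain => //; exact: ltW.
apply/ler_addgt0Pr => d d0.
have t20 : 0 < 2 * t by rewrite mulr_gt0.
have [n /ltW phin] := cvg_mesh (cvg_quotient_error tg) t20 d0.
set e2 := 2 * t / n.+1%:R in phin.
pose e := t / n.+1%:R.
have e2E : e2 = e + e by rewrite /e2 /e; ring.
have e0 : 0 < e by rewrite divr_gt0.
have ne : n.+1%:R * e = t by rewrite /e mulrCA divff ?mulr1 // pnatr_eq0.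
have s0 j : 0 <= j%:R * e by rewrite mulr_ge0 // ltW.
have sS j : j.+1%:R * e = e + j%:R * e by rewrite -natr1 mulrDl mul1r addrC.
pose u j := P (j%:R * e) f.
have uS j : u j.+1 = P e (u j) by rewrite /u sS (semigroup_add hP) // ltW.
have Tu j : T (u j, P (j%:R * e) g) by exact: semigroup_domain.
have hu j : ell2 (u j) by have [] := generator_ell2 (Tu j).
pose A j := nrm (u j) ^+ 2.
pose D j := fun x => u j x - u j.+2 x.
pose E j := nrm (D j) ^+ 2.
have TD j := generatorB (Tu j) (Tu j.+2).
have : n.+1%:R ^+ 2 * E n.+1 <= 2 * A 0%N.
  apply: decreasing_convex_le.
- by move=> k; rewrite sqr_ge0.
- move=> k; rewrite /A lerXn2r ?nnegrE ?norm2_ge0 // uS.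
  by apply: semigroup_contraction (Tu k); exact: ltW.
- move=> k; rewrite /A /E /D !sqr_norm2 //; last exact: ell2B.
  have -> : dot (u k.+1) (u k.+1) = dot (u k) (u k.+2).
    rewrite [in RHS]uS {1}uS.
    by rewrite (semigroup_sym (ltW e0) (Tu k) (Tu k.+1)).
  rewrite dotBl ?dotBr ?(dotC _ (u k.+2) (u k)) //; last exact: ell2B.
  by ring.
- by move=> k; rewrite sqr_ge0.
- move=> k; rewrite /E lerXn2r ?nnegrE ?norm2_ge0 //.
  have -> : D k.+1 = P e (D k).
    by rewrite /D (semigroupB hP (ltW e0)) // -!uS.
  by apply: semigroup_contraction (TD k); exact: ltW.
rewrite /A /E.
have -> : u 0%N = f by rewrite /u mul0r (semigroup_0 hP).
have DE : nrm (D n.+1) = nrm (fun x => P e2 (P t f) x - P t f x).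
  rewrite [LHS]norm2C; congr norm2; apply/funext => x.
  have -> : P t f = u n.+1 by rewrite /u ne.
  by rewrite 2!uS e2E (semigroup_add hP (ltW e0) (ltW e0)).
rewrite DE; set q := nrm _ => qle.
have e20 : 0 < e2 by rewrite e2E addr_gt0.
have q_le : q <= e2 * (nrm f / t).
  rewrite -ler_sqr ?nnegrE ?norm2_ge0 //; last first.
    by apply: mulr_ge0; [exact: ltW|rewrite divr_ge0 ?norm2_ge0 // ltW].
  have n0 : 0 < n.+1%:R ^+ 2 :> R by rewrite exprn_gt0.
  rewrite -(ler_pM2l n0); apply: le_trans qle _.
  have -> : n.+1%:R ^+ 2 * (e2 * (nrm f / t)) ^+ 2 = 4 * nrm f ^+ 2.
    have ne2 : n.+1%:R * e2 = 2 * t by rewrite e2E -ne; ring.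
    rewrite -exprMn (mulrA n.+1%:R) ne2; field; exact: lt0r_neq0.
  by rewrite ler_wpM2r ?sqr_ge0 // ler_nat.
rewrite -(ler_pM2l e20).
have hPg : ell2 (P t g) by apply: Pe => //; exact: ltW.
have hPf : ell2 (P t f) by apply: Pe => //; exact: ltW.
have hPPf : ell2 (P e2 (P t f)) by apply: Pe => //; exact: ltW.
rewrite norm2Zp // mulrDr.
have -> : (fun x => e2 * P t g x) =
   (fun x => remainder (P t f) (P t g) e2 x - (P e2 (P t f) x - P t f x)).
  by apply/funext => x; rewrite /remainder; ring.
apply: le_trans (norm2B m_gt0 (ell2_remainder tg e20) (ell2B m_gt0 hPPf hPf)) _.
rewrite addrC lerD // norm2_remainder // ler_wpM2l ?(ltW e20) //.
by apply: le_trans phin; exact: ler_norm.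
Qed.

End Generator.

(** * The Neumann semigroup of a birth-death chain *)

Section FiniteSupport.
Variable R : realType.
Implicit Types (u f : nat -> R).

Lemma CcP f : Cc f <-> exists n, forall k, (n <= k)%N -> f k = 0.
Proof.
split=> [|[n fn]].
  move=> /finite_seqP[X XE]; exists (\max_(x <- X) x).+1 => k nk.
  apply/eqP; apply: contraT => fk0.
  have : [set` X] k by rewrite -XE.
  move=> /= kX; have := @leq_bigmax_seq _ X xpredT id k kX isT.
  by move/(leq_trans nk); rewrite ltnn.
apply: (@sub_finite_set _ _ `I_n); last exact: finite_II.
by move=> k /= fk; rewrite ltnNge; apply: contra fk => /fn ->.
Qed.

Lemma series_eventually u n : (forall k, (n <= k)%N -> u k = 0) ->
  forall p, (n <= p)%N -> series u p = series u n.
Proof.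
move=> un p np; rewrite /series /= (big_cat_nat (leq0n n) np) /= [X in _ + X]big_nat.
by rewrite [X in _ + X]big1 ?addr0 // => k /andP[/un].
Qed.

Lemma cvg_series_eventually u n : (forall k, (n <= k)%N -> u k = 0) ->
  series u @ \oo --> series u n.
Proof.
move=> un; apply: (@cvg_trans _ (cst (series u n) @ \oo)); last exact: cvg_cst.
apply: near_eq_cvg; exists n => // p /= np; exact/esym/series_eventually.
Qed.

Lemma limn_series_eventually u n : (forall k, (n <= k)%N -> u k = 0) ->
  limn (series u) = series u n.
Proof. by move=> /cvg_series_eventually un; exact/cvg_lim. Qed.

Lemma Cc_ell2 (m : nat -> R) f : (forall x, 0 < m x) -> Cc f -> ell2 m f.
Proof.
move=> m0 /CcP[n fn]; apply/(ell2P m0)/cvg_ex; exists (series (fun x => f x * f x * m x) n).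
by apply: cvg_series_eventually => k /fn ->; rewrite !mul0r.
Qed.

Lemma norm2_mono (m : nat -> R) f u : (forall x, 0 < m x) -> ell2 m u ->
  (forall x, `|f x| <= `|u x|) -> ell2 m f /\ norm2 m f <= norm2 m u.
Proof.
move=> m0 hu fu; apply: norm2_le => //; first exact: norm2_ge0.
move=> n; rewrite sqr_norm2 //; apply: le_trans (series_sqr_le_dot m0 n hu).
rewrite /series /=; apply: ler_sum => k _; rewrite ler_wpM2r ?(ltW (m0 k)) //.
rewrite -!expr2 -(@real_normK _ (f k)) ?num_real // -(@real_normK _ (u k)) ?num_real //.
by rewrite lerXn2r ?nnegrE.
Qed.

End FiniteSupport.

Section Chain.
Variables (R : realType) (m : nat -> R) (b : nat -> nat -> R).
Hypothesis hb : birth_death_chain m b.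
Implicit Types (f g h c : nat -> R).

Local Notation Lap := (formal_laplacian m b).

Let m_gt0 x : 0 < m x. Proof. exact: bd_measure_gt0 hb x. Qed.

Lemma conductance_gt0 k : 0 < b k k.+1.
Proof. by apply/(bd_weight_gt0 hb); lia. Qed.

Lemma conductance_eq0 x y : (x <> y.+1)%N -> (y <> x.+1)%N -> b x y = 0.
Proof.
move=> xy yx; apply/eqP; rewrite eq_le (bd_weight_ge0 hb) andbT leNgt.
by apply/negP => /(bd_weight_gt0 hb); lia.
Qed.

(** The shift by one vertex; the value [0] at the left end encodes that no edge
    leaves the half-line there. *)
Definition lag (u : nat -> R) x : R := if x is k.+1 then u k else 0.

Lemma cvg_neighbours c x : series (fun y => b x y * c y) @ \oo -->
  b x x.+1 * c x.+1 + (if x is k.+1 then b k k.+1 * c k else 0).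
Proof.
have H y : (x.+2 <= y)%N -> b x y * c y = 0.
  by move=> xy; rewrite conductance_eq0 ?mul0r //; lia.
have := cvg_series_eventually H.
rewrite !seriesSr (conductance_eq0 (x := x) (y := x)); try lia.
rewrite mul0r addr0 addrC; suff -> : series (fun y => b x y * c y) x =
  (if x is k.+1 then b k k.+1 * c k else 0) by [].
case: x H => [|k] H; first by rewrite /series /= big_geq.
rewrite seriesSr (bd_weight_sym hb) /series /= big_nat big1 ?add0r //.
by move=> y /andP[_ yk]; rewrite conductance_eq0 ?mul0r //; lia.
Qed.

Definition flux f k : R := b k k.+1 * (f k.+1 - f k).

Lemma laplacianE f x : Lap f x * m x = lag (flux f) x - flux f x.
Proof.
rewrite /formal_laplacian (cvg_lim _ (@cvg_neighbours (fun y => f x - f y) x)) //.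
rewrite mulrAC mulVf ?gt_eqF // mul1r /flux; case: x => [|k] /=; ring.
Qed.

Lemma series_laplacian f n : series (fun k => Lap f k * m k) n.+1 = - flux f n.
Proof.
elim: n => [|n IH]; rewrite seriesSr laplacianE /=.
  by rewrite /series /= big_geq // add0r sub0r.
by rewrite IH addrA addNr sub0r.
Qed.

Lemma series_laplacian_by_parts f h n :
  series (fun k => Lap f k * h k * m k) n.+1 =
  series (fun k => b k k.+1 * (f k.+1 - f k) * (h k.+1 - h k)) n - flux f n * h n.
Proof.
elim: n => [|n IH]; rewrite seriesSr mulrAC laplacianE /=.
  by rewrite /series /= !big_geq // sub0r mulNr.
rewrite IH [in RHS]seriesSr /flux; ring.
Qed.

(** The boundary term of Green's formula on [0, n]; it is also
    [b n n.+1 * (f n * g n.+1 - f n.+1 * g n)]. *)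
Definition wronskian f g n : R := f n * flux g n - g n * flux f n.

Lemma green f g n :
  series (fun k => Lap f k * g k * m k) n.+1 - series (fun k => f k * Lap g k * m k) n.+1
  = wronskian f g n.
Proof.
have -> : (fun k => f k * Lap g k * m k) = (fun k => Lap g k * f k * m k).
  by apply/funext => k; rewrite (mulrC (f k)).
rewrite !series_laplacian_by_parts /wronskian.
set s1 := series _ n; set s2 := series _ n.
have -> : s1 = s2 by rewrite /s1 /s2; congr (series _ n); apply/funext=> k; ring.
by ring.
Qed.

Lemma laplacian_eventually f n : (forall k, (n <= k)%N -> f k.+1 = f k) ->
  forall k, (n < k)%N -> Lap f k = 0.
Proof.
move=> fn [//|k] nk; apply: (@mulIf _ (m k.+1)); first by rewrite gt_eqF.
by rewrite laplacianE mul0r /= /flux (fn k.+1 (leqW nk)) (fn k nk) !subrr !mulr0 subrr.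
Qed.

Lemma Cc_laplacian f n : (forall k, (n <= k)%N -> f k.+1 = f k) -> Cc (Lap f).
Proof. by move=> /laplacian_eventually H; apply/CcP; exists n.+1. Qed.

Definition edge_product f h k : R := b k k.+1 * (f k.+1 - f k) * (h k.+1 - h k).

Lemma cvg_vertex_form f h x :
  series (fun y => b x y * (f x - f y) * (h x - h y)) @ \oo -->
  edge_product f h x + lag (edge_product f h) x.
Proof.
have := @cvg_neighbours (fun y => (f x - f y) * (h x - h y)) x.
have -> : (fun y => b x y * ((f x - f y) * (h x - h y))) =
  (fun y => b x y * (f x - f y) * (h x - h y)) by apply/funext => y; rewrite mulrA.
suff -> : b x x.+1 * ((f x - f x.+1) * (h x - h x.+1)) +
   (if x is k.+1 then b k k.+1 * ((f x - f k) * (h x - h k)) else 0) =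
   edge_product f h x + lag (edge_product f h) x by [].
by rewrite /edge_product; case: x => [|k] /=; ring.
Qed.

(** Each edge contributes to both of its endpoints, except the last one, whose
    right endpoint lies outside the segment. *)
Lemma series_edge_product f h n :
  series (fun x => edge_product f h x + lag (edge_product f h) x) n.+1 =
  2 * series (edge_product f h) n + edge_product f h n.
Proof.
elim: n => [|n IH]; rewrite seriesSr /=.
  by rewrite /series /= !big_geq // !(add0r, mulr0, addr0).
by rewrite IH [in RHS]seriesSr; ring.
Qed.

Lemma neumann_formE f h : neumann_form b f h =
  2^-1 * limn (series (fun x => edge_product f h x + lag (edge_product f h) x)).
Proof.
rewrite /neumann_form; congr (_ * _); congr (limn (series _)); apply/funext => x.
exact/cvg_lim/cvg_vertex_form.
Qed.

Lemma neumann_form_eventually f h n : (forall k, (n <= k)%N -> edge_product f h k = 0) ->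
  neumann_form b f h = series (edge_product f h) n.
Proof.
move=> H; rewrite neumann_formE (@limn_series_eventually _ _ n.+1).
  by rewrite series_edge_product H // addr0 mulrA mulVf ?mul1r // pnatr_eq0.
by move=> [//|k] nk /=; rewrite (H k nk) (H k.+1 (leqW nk)) addr0.
Qed.

Lemma edge_product_ge0 f k : 0 <= edge_product f f k.
Proof. by rewrite /edge_product -mulrA mulr_ge0 // ?(ltW (conductance_gt0 k)) // -expr2 sqr_ge0. Qed.

Lemma vertex_energy_ge0 f x : 0 <= edge_product f f x + lag (edge_product f f) x.
Proof.
by rewrite addr_ge0 ?edge_product_ge0 //; case: x => //= k; exact: edge_product_ge0.
Qed.

Lemma neumann_energy_ltyP f : (neumann_energy b f < +oo)%E <->
  cvgn (series (fun x => edge_product f f x + lag (edge_product f f) x)).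
Proof.
rewrite -(nneseries_ltyP (vertex_energy_ge0 f)) /neumann_energy.
have -> : (\sum_(x <oo) \sum_(y <oo) (b x y * (f x - f y) ^+ 2)%:E)%E =
  (\sum_(x <oo) (edge_product f f x + lag (edge_product f f) x)%:E)%E.
  apply: eq_eseriesr => x _; have cv := @cvg_vertex_form f f x.
  rewrite -(cvg_lim _ cv) // -EFin_lim; last by apply/cvg_ex; eexists; exact: cv.
  congr (limn _); apply/funext => n /=; rewrite /series /= -sumEFin.
  by apply: eq_bigr => y _; rewrite expr2 mulrA.
set y := (\sum_(x <oo) _)%E.
have y0 : (0 <= y)%E.
  by apply: nneseries_ge0 => x _ _; rewrite lee_fin; exact: vertex_energy_ge0.
case: y y0 => [r|//|//] _; split; rewrite ?ltry //.
by rewrite gt0_muley ?lte_fin ?invr_gt0.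
Qed.

Lemma neumann_dom_eventually f n : ell2 m f -> (forall k, (n <= k)%N -> f k.+1 = f k) ->
  neumann_dom m b f.
Proof.
move=> hf fn; split=> //; apply/neumann_energy_ltyP/cvg_ex.
exists (series (fun x => edge_product f f x + lag (edge_product f f) x) n.+1).
apply: cvg_series_eventually => -[//|k] nk /=.
by rewrite /edge_product (fn k.+1 (leqW nk)) (fn k nk) !subrr !mulr0 addr0.
Qed.

(** A function that is constant from some vertex on has no flux at infinity, so
    summation by parts against any function of finite energy has no boundary
    term. *)
Lemma LN_eventually f n : ell2 m f -> (forall k, (n <= k)%N -> f k.+1 = f k) ->
  LN m b (f, Lap f).
Proof.
move=> hf fn; split=> /=; first exact: neumann_dom_eventually fn.
  by apply: Cc_ell2 => //; exact: Cc_laplacian fn.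
move=> h [hh _]; rewrite (@neumann_form_eventually _ _ n); last first.
  by move=> k nk; rewrite /edge_product fn // subrr mulr0 mul0r.
rewrite /dot (@limn_series_eventually _ _ n.+1); last first.
  by move=> k nk; rewrite (laplacian_eventually fn) // !mul0r.
by rewrite series_laplacian_by_parts /flux fn // subrr mulr0 mul0r subr0.
Qed.

Lemma neumann_form_sym f h : neumann_form b f h = neumann_form b h f.
Proof.
rewrite /neumann_form; congr (_ * _); congr (limn (series _)); apply/funext => x.
by congr (limn (series _)); apply/funext => y; rewrite mulrAC.
Qed.

Lemma LN_sym f g h k : LN m b (f, g) -> LN m b (h, k) -> dot m g h = dot m f k.
Proof.
move=> [/= df _ hf] [/= dh _ hh]; rewrite -hf // neumann_form_sym hh //.
exact: dotC.
Qed.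

Lemma LN_ge0 f g : LN m b (f, g) -> 0 <= dot m g f.
Proof.
move=> [/= df _ hf]; rewrite -hf // neumann_formE mulr_ge0 ?invr_ge0 //.
have cs := (neumann_energy_ltyP f).1 df.2.
apply: le_trans (series_le_limn 0 (vertex_energy_ge0 f) cs).
by rewrite /series /= big_geq.
Qed.

Definition scale n : R := series (fun k => (b k k.+1)^-1) n.

Lemma scaleS n : scale n.+1 = scale n + (b n n.+1)^-1.
Proof. exact: seriesSr. Qed.

Lemma scale_homo : {homo scale : n p / (n <= p)%N >-> n <= p}.
Proof.
by apply: series_homo => k; rewrite invr_ge0 ltW // conductance_gt0.
Qed.

Lemma scale_ge0 n : 0 <= scale n.
Proof. by have := scale_homo (leq0n n); rewrite {1}/scale /series /= big_geq. Qed.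

(** The test function [k |-> scale (minn k n)] has increments
    [1 / b k k.+1] below [n] and none above, so its form with [f] telescopes to
    [f n - f 0]. *)
Lemma LN_oscillation f g n : ell2 m scale -> LN m b (f, g) ->
  `|f n - f 0%N| <= norm2 m g * norm2 m scale.
Proof.
move=> hS [/= df hg hf]; pose p k := scale (minn k n).
have [hp pS] : ell2 m p /\ norm2 m p <= norm2 m scale.
  apply: norm2_mono => // k; rewrite !ger0_norm ?scale_ge0 //.
  exact/scale_homo/geq_minl.
have pn k : (n <= k)%N -> p k.+1 = p k.
  by move=> nk; rewrite /p (minn_idPr nk) (minn_idPr (leqW nk)).
have -> : f n - f 0%N = neumann_form b f p.
  rewrite (@neumann_form_eventually _ _ n); last first.
    by move=> k nk; rewrite /edge_product pn // subrr mulr0.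
  transitivity (series (fun k => f k.+1 - f k) n); first by rewrite /series /= telescope_sumr.
  rewrite /series /=; apply: eq_big_nat => k /andP[_ kn].
  rewrite /edge_product /p (minn_idPl (ltnW kn)) (minn_idPl kn) scaleS addrAC subrr add0r.
  by rewrite mulrAC divff ?mul1r // gt_eqF // conductance_gt0.
rewrite hf; last exact: neumann_dom_eventually pn.
apply: le_trans (cauchy_schwarz m_gt0 hg hp) _.
by rewrite ler_wpM2l // norm2_ge0.
Qed.

(** [scale] is bounded below by a positive constant away from the vertex [0]. *)
Lemma ell2_one : ell2 m scale -> ell2 m (fun=> 1).
Proof.
move=> hS; have s1 : 0 < scale 1.
  by rewrite scaleS /scale /series /= big_geq // add0r invr_gt0 conductance_gt0.
have h1 : ell2 m (fun k => if (k < 1)%N then 0 else 1).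
  apply: (@ell2_bounded _ _ m_gt0 scale _ (scale 1)^-1) => // k.
  rewrite ler_pdivlMl //; case: ltnP => k1; first by rewrite normr0 mulr0.
  by rewrite normr1 mulr1 ger0_norm ?scale_ge0 // scale_homo.
have h0 : ell2 m (fun k => if (k < 1)%N then 1 else 0).
  by apply: Cc_ell2 => //; apply/CcP; exists 1%N => k k1; rewrite ltnNge k1.
have := ell2D m_gt0 h1 h0; congr ell2; apply/funext => k.
by case: ifP => _; rewrite ?addr0 ?add0r.
Qed.

(** The heat [P t h] of the far part [h] of the constant [1] is uniformly small:
    at [0] by contractivity, and elsewhere by the oscillation bound together
    with smoothing. The remaining finitely supported part of [1] therefore has
    heat close to [1] at infinity. *)
Lemma not_feller PN : exp_semigroup m (LN m b) PN -> ell2 m scale -> ~ feller PN.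
Proof.
move=> hP hS [t t0 FP].
have h1 := ell2_one hS.
(* [norm2 h * C] bounds [PN t h] uniformly: [b1] and [b0] below give the two summands. *)
pose C := norm2 m scale / t + (Num.sqrt (m 0%N))^-1.
have sm0 : 0 < Num.sqrt (m 0%N) by rewrite sqrtr_gt0.
have C0 : 0 < C.
  by rewrite /C ltr_wpDl ?invr_gt0 // divr_ge0 ?norm2_ge0 // ltW.
have e0 : 0 < 2^-1 / C by rewrite divr_gt0 // invr_gt0.
have [N /(_ N (leqnn N))] := ell2_tail m_gt0 h1 e0.
set h := (X in norm2 m X) => hsmall.
have h_const k : (N <= k)%N -> h k.+1 = h k.
  by move=> Nk; rewrite /h !ltnNge Nk (leqW Nk).
have hh : ell2 m h.
  apply: (norm2_mono m_gt0 h1 _).1 => k; rewrite /h normr1.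
  by case: ifP => _; rewrite ?normr0 ?normr1.
pose g k : R := 1 - h k.
have gC : Cc g by apply/CcP; exists N => k Nk; rewrite /g /h ltnNge Nk /= subrr.
have hg := Cc_ell2 m_gt0 gC.
have P1 : PN t (fun=> 1) = fun=> 1.
  apply: (semigroup_fixed m_gt0 hP LN_ge0 (ltW t0)).
  have -> : (fun=> 0) = Lap (fun=> 1).
      apply/funext => x; apply: (@mulIf _ (m x)); first by rewrite gt_eqF.
      rewrite laplacianE /flux !mul0r; case: x => [|k] /=; by rewrite !subrr !mulr0 ?subrr.
    by apply: (@LN_eventually _ 0%N).
have Ph : PN t h = fun x => 1 - PN t g x.
  have -> : h = fun k => 1 - g k by apply/funext => k; rewrite /g opprB addrC subrK.
  by rewrite (semigroupB hP (ltW t0) h1 hg) P1.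
have hLN := LN_eventually hh h_const.
have [phi /CcP[n phin] gphi] := FP g gC (2^-1) ltac:(by rewrite invr_gt0).
have gn := gphi n; rewrite phin // subr0 in gn.
have osc := LN_oscillation n hS (semigroup_domain m_gt0 hP (ltW t0) hLN).
have smooth := semigroup_smoothing m_gt0 hP LN_sym LN_ge0 t0 hLN.
have contr := semigroup_contraction m_gt0 hP LN_ge0 (ltW t0) hLN.
have hPh : ell2 m (PN t h) by apply: (semigroup_ell2 hP) => //; exact: ltW.
have at0 := ell2_pointwise m_gt0 0%N hPh.
have b0 : `|PN t h 0%N| <= norm2 m h * (Num.sqrt (m 0%N))^-1.
  rewrite mulrC ler_pdivlMl //; exact: le_trans at0 contr.
have b1 : `|PN t h n - PN t h 0%N| <= norm2 m h * (norm2 m scale / t).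
  apply: le_trans osc _; rewrite mulrA mulrAC ler_wpM2r ?norm2_ge0 //.
have b2 : `|PN t h n| <= norm2 m h * C.
  rewrite /C mulrDr -(subrK (PN t h 0%N) (PN t h n)).
  exact: le_trans (ler_normD _ _) (lerD b1 b0).
have b3 : norm2 m h * C < 2^-1 by rewrite -ltr_pdivlMr.
have := le_lt_trans b2 b3; rewrite Ph => b4.
have := le_lt_trans (ler_normD (1 - PN t g n) (PN t g n)) (ltrD b4 gn).
by rewrite subrK normr1; lra.
Qed.

End Chain.

(** * Hamburger's criterion *)

(** The step common to the divergence theorems of Abel ([rho] the partial sums
    of a divergent series [m]) and Dini ([rho] the remainders of a convergent
    one): multiples of the tails of [q] bound the mass of [m] on a block relative
    to [rho], and they become arbitrarily small. *)
Lemma sum_le_half_bound (R : realType) (m q rho : nat -> R) (c K : R) (N0 : nat) :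
  0 < c -> 0 <= K -> (forall n, 0 <= q n) -> cvgn (series q) ->
  (forall n, (N0 <= n)%N -> c * m n <= K * q n * rho n) ->
  exists N, forall p B, (N <= p)%N -> 0 <= B ->
    (forall n, (N <= n < p)%N -> rho n <= B) -> 2 * (series m p - series m N) <= B.
Proof.
move=> c0 K0 q0 cq H.
have e0 : 0 < c / (2 * (K + 1)) by rewrite divr_gt0 // mulr_gt0 // ltr_wpDl.
have /cvgrPdist_lt/(_ _ e0)[N1 _ N1P] := cq.
set N := maxn N0 N1; exists N => p B Np B0 rB.
have qN : \sum_(N <= n < p) q n <= c / (2 * (K + 1)).
  apply: le_trans (ltW (N1P N (leq_maxr _ _))).
  rewrite ger0_norm ?subr_ge0 ?series_le_limn // lerBrDr.
  have := series_le_limn p q0 cq.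
  by rewrite {1}/series /= (big_cat_nat (leq0n N) Np) /= addrC.
have -> : series m p - series m N = \sum_(N <= n < p) m n.
  by rewrite /series /= (big_cat_nat (leq0n N) Np) /= addrAC subrr add0r.
have : c * \sum_(N <= n < p) m n <= K * B * \sum_(N <= n < p) q n.
  rewrite !mulr_sumr big_nat [leRHS]big_nat; apply: ler_sum => n /andP[Nn np].
  apply: le_trans (H n _) _; first exact: leq_trans (leq_maxl _ _) Nn.
  by rewrite mulrAC ler_wpM2r // ler_wpM2l // rB // Nn.
set s := \sum_(N <= n < p) m n => cs.
have KB : K * B * \sum_(N <= n < p) q n <= (K + 1) * B * (c / (2 * (K + 1))).
  apply: ler_pM => //; first by rewrite mulr_ge0.
    by apply: sumr_ge0.
  by rewrite ler_wpM2r // lerDl.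
have K1 : K + 1 != 0 by rewrite gt_eqF // ltr_wpDl.
have E : (K + 1) * B * (c / (2 * (K + 1))) = c * (B / 2) by field.
rewrite E in KB; have := le_trans cs KB; rewrite ler_pM2l //; lra.
Qed.

Section EssentialSelfAdjointness.
Variables (R : realType) (m : nat -> R) (b : nat -> nat -> R).
Hypothesis hb : birth_death_chain m b.
Implicit Types (f g h c : nat -> R).

Local Notation Lap := (formal_laplacian m b).
Local Notation flux := (flux b).
Local Notation scale := (scale b).
Local Notation wronskian := (wronskian b).

Let m_gt0 x : 0 < m x. Proof. exact: bd_measure_gt0 hb x. Qed.

Definition below n : nat -> R := fun k => if (k < n)%N then 1 else 0.
Definition above n : nat -> R := fun k => if (k < n)%N then 0 else 1.

Lemma ell2_below n : ell2 m (below n).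
Proof.
by apply: Cc_ell2 => //; apply/CcP; exists n => k nk; rewrite /below ltnNge nk.
Qed.

Lemma dot_below u n : dot m u (below n) = series (fun k => u k * m k) n.
Proof.
rewrite /dot (@limn_series_eventually _ _ n).
  rewrite /series /=; apply: eq_big_nat => k /andP[_ kn].
  by rewrite /below kn mulr1.
by move=> k nk; rewrite /below ltnNge nk mulr0 mul0r.
Qed.

Lemma sqr_norm2_below n : norm2 m (below n) ^+ 2 = series m n.
Proof.
rewrite sqr_norm2 //; last exact: ell2_below.
rewrite dot_below /series /=; apply: eq_big_nat => k /andP[_ kn].
by rewrite /below kn mul1r.
Qed.

Lemma flux_below f n : flux f n = - dot m (Lap f) (below n.+1).
Proof. by rewrite dot_below (series_laplacian hb) opprK. Qed.

(** Cauchy-Schwarz, as the flux is minus the total Laplacian over [0, n]. *)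
Lemma sqr_flux_le_below f n : ell2 m (Lap f) ->
  flux f n ^+ 2 <= norm2 m (Lap f) ^+ 2 * series m n.+1.
Proof.
move=> hLf; rewrite flux_below sqrrN -sqr_norm2_below -exprMn.
rewrite -(@real_normK _ (dot _ _ _)) ?num_real //.
rewrite lerXn2r ?nnegrE ?mulr_ge0 ?norm2_ge0 //.
by apply: cauchy_schwarz => //; exact: ell2_below.
Qed.

Lemma aboveE n : above n = fun k => 1 - below n k.
Proof. by apply/funext => k; rewrite /above /below; case: ifP => _; rewrite ?subrr ?subr0. Qed.

Lemma cvg_flux f : ell2 m (fun=> 1) -> ell2 m (Lap f) ->
  flux f n @[n --> \oo] --> - dot m (Lap f) (fun=> 1).
Proof.
move=> h1 hLf.
have -> : flux f = fun n => - series (fun k => Lap f k * 1 * m k) n.+1.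
  apply/funext => n; rewrite -[LHS]opprK -(series_laplacian hb); congr (- series _ _).
  by apply/funext => k; rewrite mulr1.
apply: cvgN; rewrite (cvg_shiftS (series (fun k => Lap f k * 1 * m k))).
exact: cvg_series_dot.
Qed.

(** When the total Laplacian vanishes, the flux is also the total Laplacian over
    the complement of [0, n]. *)
Lemma sqr_flux_le_above f n : ell2 m (fun=> 1) -> ell2 m (Lap f) ->
  dot m (Lap f) (fun=> 1) = 0 ->
  flux f n ^+ 2 <= norm2 m (Lap f) ^+ 2 * (limn (series m) - series m n.+1).
Proof.
move=> h1 hLf d0; have hi := ell2_below n.+1.
have hfin : ell2 m (above n.+1) by rewrite aboveE; exact: ell2B.
have -> : flux f n = dot m (Lap f) (above n.+1).
  by rewrite aboveE dotBr // d0 sub0r flux_below.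
have -> : limn (series m) - series m n.+1 = norm2 m (above n.+1) ^+ 2.
  rewrite sqr_norm2 //.
  have -> : dot m (above n.+1) (above n.+1) = dot m (above n.+1) (fun=> 1).
    rewrite /dot; congr (limn (series _)); apply/funext => k.
    by rewrite /above; case: ifP; rewrite ?mul0r.
  rewrite aboveE dotBl //; congr (_ - _).
    by rewrite /dot; congr (limn (series _)); apply/funext => k; rewrite !mul1r.
  by rewrite dotC dot_below; congr (series _ _); apply/funext=> k; rewrite mul1r.
rewrite -exprMn -(@real_normK _ (dot _ _ _)) ?num_real //.
by rewrite lerXn2r ?nnegrE ?mulr_ge0 ?norm2_ge0 //; exact: cauchy_schwarz.
Qed.

(** A flux with a nonzero limit at infinity makes [f] grow at least like a
    multiple of [scale]. *)
Lemma total_laplacian_eq0 f : ell2 m (fun=> 1) -> ~ ell2 m scale ->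
  ell2 m f -> ell2 m (Lap f) -> dot m (Lap f) (fun=> 1) = 0.
Proof.
move=> h1 nS hf hLf; apply/eqP; apply: contraT => d0; exfalso; apply: nS.
have cF := cvg_flux h1 hLf; set d := dot m _ _ in d0 cF.
have dp : 0 < `|d| / 2 by rewrite divr_gt0 // normr_gt0.
have /cvgrPdist_lt/(_ _ dp)[N _ NP] := cF.
have dF n : (N <= n)%N -> d ^+ 2 / 2 <= - d * flux f n.
  move=> Nn; have := NP n Nn; rewrite -normrN opprB opprK => H.
  have : d * (flux f n + d) <= d ^+ 2 / 2.
    apply: le_trans (ler_norm _) _; rewrite normrM.
    rewrite -(@real_normK _ d) ?num_real // expr2 -mulrA.
    by rewrite ler_wpM2l // ltW.
  rewrite mulrDr -expr2; lra.
have d2 : 0 < d ^+ 2 / 2 by rewrite divr_gt0 // exprn_even_gt0.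
have inc j : d ^+ 2 / 2 * (scale (N + j)%N - scale N) <= - d * (f (N + j)%N - f N).
  elim: j => [|j IH]; first by rewrite addn0 !subrr !mulr0.
  rewrite addnS scaleS.
  have w0 := conductance_gt0 hb (N + j)%N.
  have fE : f (N + j).+1 = f (N + j)%N + flux f (N + j)%N / b (N + j)%N (N + j).+1.
    by rewrite /flux; field; rewrite gt_eqF.
  have := ler_wpM2r (ltW (etrans (invr_gt0 _) w0)) (dF (N + j)%N (leq_addr _ _)).
  rewrite fE; move: IH; set iw := (b _ _)^-1; set F := flux f _.
  set x := scale _; set y := scale N; set u := f _; set v := f N.
  move=> A B; have := lerD A B; rewrite -subr_ge0 => C; rewrite -subr_ge0.
  by apply: le_trans C _; rewrite le_eqVlt; apply/orP; left; apply/eqP; ring.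
have bound n : scale n <= (scale N + 2 / `|d| * `|f N|) + 2 / `|d| * `|f n|.
  have dn0 : 0 < `|d| by rewrite normr_gt0.
  have c0 : 0 <= 2 / `|d| by rewrite divr_ge0.
  have [Nn|nN] := leqP N n; last first.
    rewrite -addrA; apply: ler_wpDr; first by rewrite addr_ge0 // mulr_ge0.
    exact: (scale_homo hb (ltnW nN)).
  have := inc (n - N)%N; rewrite subnKC // => H.
  have {}H : d ^+ 2 / 2 * (scale n - scale N) <= `|d| * (`|f n| + `|f N|).
    apply: le_trans H _; apply: le_trans (ler_norm _) _.
    by rewrite normrM normrN ler_wpM2l // ler_normB.
  rewrite -(@real_normK _ d) ?num_real // expr2 -!mulrA ler_pM2l // in H.
  rewrite -addrA -mulrDr addrC -lerBlDr.
  rewrite -(ler_pM2l dn0); apply: le_trans (_ : 2 * (`|f n| + `|f N|) <= _); first by lra.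
  by rewrite mulrA (mulrCA `|d|) divff ?mulr1 ?gt_eqF // addrC.
have hdom : ell2 m (fun n => 2 / `|d| * `|f n| + (scale N + 2 / `|d| * `|f N|) * 1).
  apply: ell2_lin => //; last exact: ell2Z.
  by apply: (@ell2_bounded _ _ m_gt0 f _ 1) => // x; rewrite normr_id mul1r.
apply: (@ell2_bounded _ _ m_gt0 _ _ 1 hdom) => n.
rewrite mul1r mulr1 ger0_norm ?(scale_ge0 hb) // addrC.
exact: le_trans (bound n) (ler_norm _).
Qed.

Lemma cvg_wronskian f g : ell2 m f -> ell2 m (Lap f) -> ell2 m g -> ell2 m (Lap g) ->
  wronskian f g n @[n --> \oo] --> dot m (Lap f) g - dot m f (Lap g).
Proof.
move=> hf hLf hg hLg.
have -> : wronskian f g = fun n => series (fun k => Lap f k * g k * m k) n.+1 -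
    series (fun k => f k * Lap g k * m k) n.+1.
  by apply/funext => n; rewrite (green hb).
apply: cvgB.
  by rewrite (cvg_shiftS (series (fun k => Lap f k * g k * m k))); exact: cvg_series_dot.
by rewrite (cvg_shiftS (series (fun k => f k * Lap g k * m k))); exact: cvg_series_dot.
Qed.

(** Weyl's limit-point property. If the Wronskian had a nonzero limit, the
    Abel-Dini step would apply to [q = (f ^+ 2 + g ^+ 2) * m], with the
    remainders of [m] as [rho] if [m] is summable, and with its partial sums
    otherwise. *)
Lemma laplacian_sym f g : ~ ell2 m scale ->
  ell2 m f -> ell2 m (Lap f) -> ell2 m g -> ell2 m (Lap g) ->
  dot m (Lap f) g = dot m f (Lap g).
Proof.
move=> nS hf hLf hg hLg; apply/eqP; rewrite -subr_eq0; apply: contraT => W0; exfalso.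
have cW := cvg_wronskian hf hLf hg hLg; set W := _ - _ in W0 cW.
have W2 : 0 < `|W| / 2 by rewrite divr_gt0 // normr_gt0.
have /cvgrPdist_lt/(_ _ W2)[N0 _ N0P] := cW.
pose c := (`|W| / 2) ^+ 2.
have c0 : 0 < c by rewrite exprn_gt0.
pose q n := (f n ^+ 2 + g n ^+ 2) * m n.
have q0 n : 0 <= q n by rewrite mulr_ge0 ?addr_ge0 ?sqr_ge0 // ltW.
have cq : cvgn (series q).
  have := is_cvg_seriesD (cvg_series_dot m_gt0 hf hf) (cvg_series_dot m_gt0 hg hg).
  by congr (cvgn (series _)); apply/funext => k; rewrite /q !fctE /=; ring.
have cFG n : (N0 <= n)%N -> c * m n <= q n * (flux f n ^+ 2 + flux g n ^+ 2).
  move=> Nn; rewrite /q [leRHS]mulrAC ler_wpM2r ?(ltW (m_gt0 n)) //.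
  have : `|W| / 2 <= `|wronskian f g n|.
    have := N0P n Nn; have := ler_normD (W - wronskian f g n) (wronskian f g n).
    rewrite subrK /=; lra.
  move=> W_le; have H : c <= wronskian f g n ^+ 2.
    by rewrite -(@real_normK _ (wronskian f g n)) ?num_real // lerXn2r ?nnegrE ?(ltW W2).
  apply: le_trans H _; rewrite /wronskian -subr_ge0.
  set F := flux f n; set G := flux g n; set u := f n; set v := g n.
  have -> : (u ^+ 2 + v ^+ 2) * (F ^+ 2 + G ^+ 2) - (u * G - v * F) ^+ 2 =
    (u * F + v * G) ^+ 2 by ring.
  exact: sqr_ge0.
clearbody q; pose K := norm2 m (Lap f) ^+ 2 + norm2 m (Lap g) ^+ 2.
have K0 : 0 <= K by rewrite addr_ge0 ?sqr_ge0.
have m0 k : 0 <= m k by exact: ltW.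
have [h1|n1] := pselect (ell2 m (fun=> 1)).
  have cm : cvgn (series m).
    have -> : m = fun k => 1 * 1 * m k by apply/funext => k; rewrite !mul1r.
    exact/(ell2P m_gt0).
  have df := total_laplacian_eq0 h1 nS hf hLf; have dg := total_laplacian_eq0 h1 nS hg hLg.
  pose tau n := limn (series m) - series m n.+1.
  have [|N NP] := @sum_le_half_bound R m q tau c K N0 c0 K0 q0 cq.
    move=> n Nn; apply: le_trans (cFG n Nn) _.
    rewrite (mulrC K) -mulrA ler_wpM2l // /K mulrDl.
    by rewrite lerD // sqr_flux_le_above.
  set L := limn (series m) in tau NP.
  have LN : series m N.+1 <= L := series_le_limn N.+1 m0 cm.
  have mN := m_gt0 N; rewrite seriesSr in LN.
  have B0 : 0 <= L - series m N by lra.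
  have : L <= series m N + (L - series m N) / 2.
    apply: limn_series_le => // p.
    have [Np|pN] := leqP N p; last first.
      by apply: le_trans (series_homo m0 (ltnW pN)) _; rewrite lerDl divr_ge0.
    have : 2 * (series m p - series m N) <= L - series m N.
      apply: (NP p _ Np B0) => n /andP[Nn _].
      by rewrite /tau lerB // series_homo // leqW.
    lra.
  lra.
have [|N NP] := @sum_le_half_bound R m q (fun n => series m n.+1) c K N0 c0 K0 q0 cq.
  move=> n Nn; apply: le_trans (cFG n Nn) _.
  rewrite (mulrC K) -mulrA ler_wpM2l // /K mulrDl.
  by rewrite lerD // sqr_flux_le_below.
have sm0 n : 0 <= series m n by rewrite /series /=; apply: sumr_ge0.
apply: n1; apply: (norm2_le m_gt0 (sqrtr_ge0 (2 * series m N)) _).1 => p.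
rewrite sqr_sqrtr ?mulr_ge0 //.
have -> : (fun k => 1 * 1 * m k) = m by apply/funext => k; rewrite !mul1r.
have [Np|pN] := leqP N p; last first.
  by have := series_homo m0 (ltnW pN); have := sm0 N; lra.
have := NP p (series m p) Np (sm0 p) _.
have mono n : (N <= n < p)%N -> series m n.+1 <= series m p.
  by move=> /andP[_ np]; exact: series_homo.
move=> /(_ mono); lra.
Qed.

Lemma adjoint_mono (T U : graph R) : T `<=` U -> adjoint m U `<=` adjoint m T.
Proof. by move=> TU [f g] [/= hf hg H]; split=> //= h k /TU; exact: H. Qed.

Lemma wronskian_eventually f g n : (forall k, (n <= k)%N -> f k = 0) ->
  forall k, (n <= k)%N -> wronskian f g k = 0.
Proof.
move=> fn k nk; rewrite /wronskian /flux (fn k) // (fn k.+1) ?(leqW nk) //.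
by rewrite subrr !mulr0 mul0r subrr.
Qed.

Definition unit_at x : nat -> R := fun k => if k == x then 1 else 0.

Lemma series_unit_at x u p : (x < p)%N -> series (fun k => unit_at x k * u k * m k) p = u x * m x.
Proof.
move=> xp; rewrite /series /= (big_cat_nat (leq0n x) (ltnW xp)) /= big_nat big1 ?add0r.
  rewrite big_ltn // /unit_at eqxx mul1r big_nat big1 ?addr0 // => k /andP[xk _].
  by rewrite gtn_eqF // !mul0r.
by move=> k /andP[_ kx]; rewrite /unit_at ltn_eqF // !mul0r.
Qed.

Lemma dot_unit_at x u : dot m (unit_at x) u = u x * m x.
Proof.
rewrite /dot (@limn_series_eventually _ _ x.+1) ?series_unit_at //.
by move=> k xk; rewrite /unit_at gtn_eqF // !mul0r.
Qed.

Lemma Cc_unit_at x : Cc (unit_at x).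
Proof. by apply/CcP; exists x.+1 => k xk; rewrite /unit_at gtn_eqF. Qed.

Lemma Cc_laplacian_Cc f : Cc f -> Cc (Lap f).
Proof.
move=> /CcP[n fn]; apply: (@Cc_laplacian _ _ _ hb f n) => k nk.
by rewrite !fn // leqW.
Qed.

(** The adjoint of L_c is the maximal Laplacian: test with indicators of points
    in one direction, and use Green's formula, whose boundary term vanishes for
    finitely supported functions, in the other. *)
Lemma adjoint_LcE f g : adjoint m (Lc m b) (f, g) <->
  [/\ ell2 m f, ell2 m g & g = Lap f].
Proof.
split=> [[/= hf hg H]|[hf hg gE]].
  split=> //; apply/funext => x; apply: (@mulIf _ (m x)); first by rewrite gt_eqF.
  have := H (unit_at x) (Lap (unit_at x)) (conj (Cc_unit_at x) erefl).
  rewrite dot_unit_at => <-.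
  have u0 k : (x.+1 <= k)%N -> unit_at x k = 0 by move=> xk; rewrite /unit_at gtn_eqF.
  rewrite /dot (@limn_series_eventually _ _ x.+2); last first.
    move=> k xk; rewrite (@laplacian_eventually _ _ _ hb _ x.+1) ?mul0r // => j xj.
    by rewrite !u0 // leqW.
  rewrite -(@series_unit_at x (Lap f) x.+2) //.
  by apply/eqP; rewrite -subr_eq0 (green hb) (wronskian_eventually _ u0).
split=> //= h k [/= hC ->]; rewrite gE.
have [n hn] := (CcP h).1 hC.
have hh := Cc_ell2 m_gt0 hC; have hLh := Cc_ell2 m_gt0 (Cc_laplacian_Cc hC).
rewrite gE in hg; have := cvg_wronskian hh hLh hf hg => cW.
apply/eqP; rewrite -subr_eq0; apply/eqP.
apply: (cvg_unique _ cW) => //.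
apply: (@cvg_trans _ (cst (0 : R) @ \oo)); last exact: cvg_cst.
apply: near_eq_cvg; exists n => // p /= np; by rewrite (wronskian_eventually _ hn).
Qed.

Lemma Cc_dense : ell2_dense m (@Cc R).
Proof.
move=> f hf e e0; have [N /(_ N (leqnn N)) fN] := ell2_tail m_gt0 hf e0.
exists (fun k => if (k < N)%N then f k else 0).
  by apply/CcP; exists N => k Nk; rewrite ltnNge Nk.
apply: le_lt_trans fN; rewrite le_eqVlt; apply/orP; left; apply/eqP.
by congr norm2; apply/funext => k; case: ifP => _; rewrite ?subrr ?subr0.
Qed.

Lemma linear_adjoint_Lc : linear_operator m (adjoint m (Lc m b)).
Proof.
split.
- by move=> f g /adjoint_LcE[].
- by move=> f g g' /adjoint_LcE[_ _ ->] /adjoint_LcE[_ _ ->].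
- split=> /=; [exact: ell2_0|exact: ell2_0|].
  by move=> h k _; rewrite dotC dot0l dotC dot0l.
- move=> a f g h k [/= hf hg H] [/= hh hk H']; split=> /=; try exact: ell2_lin.
  move=> u v uv; have [/= uC vE] := uv.
  have hu := Cc_ell2 m_gt0 uC; have hv : ell2 m v.
    by rewrite vE; apply: Cc_ell2 => //; exact: Cc_laplacian_Cc.
  by rewrite !dot_linr // (H _ _ uv) (H' _ _ uv).
Qed.

Lemma Lc_sub_adjoint : Lc m b `<=` adjoint m (Lc m b).
Proof.
move=> [f g] [/= fC ->]; apply/adjoint_LcE; split=> //; first exact: Cc_ell2.
by apply: Cc_ell2 => //; exact: Cc_laplacian_Cc.
Qed.

(** The adjoint [A] of L_c is symmetric, hence self-adjoint. Any self-adjoint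
    [B] extending L_c satisfies [B = adjoint B `<=` A], and taking adjoints once
    more, [A = adjoint A `<=` B]. *)
Lemma essentially_self_adjoint_scale : ~ ell2 m scale -> essentially_self_adjoint m (Lc m b).
Proof.
move=> nS; set A := adjoint m (Lc m b).
have AA : adjoint m A = A.
  apply/seteqP; split; first exact/adjoint_mono/Lc_sub_adjoint.
  move=> [f g] /adjoint_LcE[hf hg gE]; split=> //= h k /adjoint_LcE[hh hk kE].
  by rewrite gE kE laplacian_sym // -?gE // -kE.
exists A; split.
  split; last exact: Lc_sub_adjoint.
  split=> //; first exact: linear_adjoint_Lc.
  move=> f hf e e0; have [g gC fg] := Cc_dense hf e0; exists g => //.
  by exists (Lap g); apply: Lc_sub_adjoint.
move=> B [[_ _ BB] LB].
have BA : B `<=` A by rewrite -BB; exact: adjoint_mono.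
apply/seteqP; split=> //.
by rewrite -AA -[X in _ `<=` X]BB; exact: adjoint_mono.
Qed.

End EssentialSelfAdjointness.

Theorem corollary8p3 (R : realType) (m : nat -> R) (b : nat -> nat -> R)
    (hb : birth_death_chain m b)
    (PN : R -> (nat -> R) -> nat -> R)
    (hPN : exp_semigroup m (LN m b) PN)
    (hF : feller PN) :
  essentially_self_adjoint m (Lc m b).
Proof. by apply: essentially_self_adjoint_scale => // hS; exact: (not_feller hb hPN hS hF). Qed.
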